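(* Let $\alpha>0$ and $\beta\in[0,+\infty]$. For any $H\in\mathcal{S}_\beta(\mathbb{R})$, the function $f:\mathbb{R}_+\to\mathbb{R}$ defined by $f(t)=\|\nabla_\beta T^\beta_tH\|_{2,\beta}^2$ is continuous.
   Context: Fix $\alpha>0$ (it only matters when $\beta=1$); $\mathbb{R}_+=[0,+\infty)$. The space $\mathcal{S}(\mathbb{R}\backslash\{0\})$: functions $H:\mathbb{R}\to\mathbb{R}$ such that (i) $H\in C^\infty(\mathbb{R}\backslash\{0\})$; (ii) $H$ is continuous from the right at $0$; (iii) for all non-negative integers $k,\ell$, $\|H\|_{k,\ell}:=\sup_{u\neq 0}\left|(1+|u|^\ell)\frac{d^kH}{du^k}(u)\right|<\infty$. For such $H$ the side limits $\frac{d^kH}{du^k}(0^+)$ and $\frac{d^kH}{du^k}(0^-)$ exist for every integer $k\ge 0$. The space $\mathcal{S}_\beta(\mathbb{R})$: - for $\beta<1$, $\mathcal{S}_\beta(\mathbb{R})$ is the usual Schwartz space $\mathcal{S}(\mathbb{R})$; - for $\beta=1$, it is the set of $H\in\mathcal{S}(\mathbb{R}\backslash\{0\})$ such that for every integer $k\ge0$, $\frac{d^{2k+1}H}{du^{2k+1}}(0^+)=\frac{d^{2k+1}H}{du^{2k+1}}(0^-)=\alpha\left(\frac{d^{2k}H}{du^{2k}}(0^+)-\frac{d^{2k}H}{du^{2k}}(0^-)\right)$; - for $\beta>1$ (including $\beta=+\infty$), it is the set of $H\in\mathcal{S}(\mathbb{R}\backslash\{0\})$ such that for every integer $k\ge0$,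 $\frac{d^{2k+1}H}{du^{2k+1}}(0^+)=\frac{d^{2k+1}H}{du^{2k+1}}(0^-)=0$. For $H\in\mathcal{S}_\beta(\mathbb{R})$: $\nabla_\beta H(u)=\frac{dH}{du}(u)$ for $u\neq0$ and $\nabla_\beta H(0)=\frac{dH}{du}(0^+)$. For a function $G:\mathbb{R}\to\mathbb{R}$, $\|G\|_{2,\beta}^2=\int_{\mathbb{R}}G(u)^2du+\frac{1}{\alpha^2}\mathbf{1}_{\beta=1}(G(0))^2$. The semigroup $T^\beta_t:\mathcal{S}_\beta(\mathbb{R})\to\mathcal{S}_\beta(\mathbb{R})$: $T^\beta_0$ is the identity. For $t>0$, let $\phi_t(x)=\frac{1}{\sqrt{4\pi t}}e^{-x^2/(4t)}$, $g_{\mathrm{even}}(x)=\frac{g(x)+g(-x)}{2}$, $g_{\mathrm{odd}}(x)=\frac{g(x)-g(-x)}{2}$, and $\mathrm{sign}(x)=1$ for $x\ge0$, $\mathrm{sign}(x)=-1$ for $x<0$. For $x\in\mathbb{R}$: - for $\beta\in[0,1)$, $T^\beta_t g(x)=\int_{\mathbb{R}}\phi_t(x-y)g(y)\,dy$; - for $\beta\in(1,+\infty]$, $T^\beta_t g(x)=\int_0^{+\infty}\left[\phi_t(x-y)+\phi_t(x+y)\right]g(y\,\mathrm{sign}(x))\,dy$; - for $\beta=1$, $$T^\beta_t g(x)=\int_{\mathbb{R}}\phi_t(x-y)g_{\mathrm{even}}(y)\,dy+\mathrm{sign}(x)e^{2\alpha|x|}\int_{|x|}^{+\infty}e^{-2\alpha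 z}\int_0^{+\infty}\left[\tfrac{z-y+4\alpha t}{2t}\phi_t(z-y)+\tfrac{z+y-4\alpha t}{2t}\phi_t(z+y)\right]g_{\mathrm{odd}}(y)\,dy\,dz.$$ *)

(* Defs.v *)
From HB Require Import structures.
From mathcomp Require Import all_boot all_order all_algebra.
From mathcomp Require Import all_classical all_reals all_analysis.

Set Implicit Arguments.
Unset Strict Implicit.
Unset Printing Implicit Defensive.

Import Order.TTheory GRing.Theory Num.Theory.
Import numFieldNormedType.Exports.

Local Open Scope ring_scope.
Local Open Scope classical_set_scope.

Section Spaces.
Context {R : realType}.
Implicit Types (H G g : R -> R) (D : set R) (alpha t x y z : R) (beta : \bar R).

(* Iterated derivatives are taken on the whole line; at u != 0 their values only
   depend on H near u, so the value of derive1n k H at 0 is never used below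
   when D excludes 0. *)
Definition seminorm D (k l : nat) H : \bar R :=
  ereal_sup [set `|(1 + `|u| ^+ l) * derive1n k H u|%:E | u in D].

Definition smooth_on D H : Prop :=
  forall (k : nat) (u : R), D u -> derivable (derive1n k H) u 1.

Definition punctured : set R := [set u | u != 0].

Definition schwartz H : Prop :=
  smooth_on setT H /\ forall k l : nat, (seminorm setT k l H < +oo)%E.

Definition schwartz_punctured H : Prop :=
  [/\ smooth_on punctured H,
      H x @[x --> 0^'+] --> H 0 &
      forall k l : nat, (seminorm punctured k l H < +oo)%E].

Definition rderiv0 (k : nat) H : R := lim (derive1n k H x @[x --> 0^'+]).

Definition lderiv0 (k : nat) H : R := lim (derive1n k H x @[x --> 0^'-]).

Definition schwartz_beta alpha beta H : Prop :=
  if (beta < 1)%E then schwartz H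
  else if beta == 1%E then
    schwartz_punctured H /\
    forall k : nat,
      rderiv0 (2 * k).+1 H = lderiv0 (2 * k).+1 H /\
      lderiv0 (2 * k).+1 H = alpha * (rderiv0 (2 * k) H - lderiv0 (2 * k) H)
  else
    schwartz_punctured H /\
    forall k : nat,
      rderiv0 (2 * k).+1 H = lderiv0 (2 * k).+1 H /\
      lderiv0 (2 * k).+1 H = 0.

Definition nabla H : R -> R :=
  fun u => if u == 0 then rderiv0 1 H else derive1 H u.

(* Valued in \bar R, so that a divergent integral is +oo. *)
Definition sqnorm alpha beta G : \bar R :=
  (\int[lebesgue_measure]_(u in setT) ((G u ^+ 2)%:E)
   + ((alpha ^+ 2)^-1 * (beta == 1%E)%:R * G 0 ^+ 2)%:E)%E.

Definition heat_kernel t x : R :=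
  (Num.sqrt (4 * pi * t))^-1 * expR (- (x ^+ 2 / (4 * t))).

Definition even_part g : R -> R := fun x => (g x + g (- x)) / 2.

Definition odd_part g : R -> R := fun x => (g x - g (- x)) / 2.

(* Unlike Num.sg, the sign of 0 is 1. *)
Definition sign x : R := if 0 <= x then 1 else -1.

Definition heat_line t g : R -> R := fun x =>
  \int[lebesgue_measure]_(y in setT) (heat_kernel t (x - y) * g y).

Definition heat_neumann t g : R -> R := fun x =>
  \int[lebesgue_measure]_(y in `[0, +oo[)
    ((heat_kernel t (x - y) + heat_kernel t (x + y)) * g (y * sign x)).

Definition heat_robin alpha t g : R -> R := fun x =>
  \int[lebesgue_measure]_(y in setT) (heat_kernel t (x - y) * even_part g y)
  + sign x * expR (2 * alpha * `|x|) *
    \int[lebesgue_measure]_(z in `[`|x|, +oo[)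
      (expR (- (2 * alpha * z)) *
       \int[lebesgue_measure]_(y in `[0, +oo[)
         (((z - y + 4 * alpha * t) / (2 * t) * heat_kernel t (z - y)
           + (z + y - 4 * alpha * t) / (2 * t) * heat_kernel t (z + y))
          * odd_part g y)).

(* Only meaningful for 0 <= t. *)
Definition semigroup alpha beta t g : R -> R :=
  if t == 0 then g
  else if (beta < 1)%E then heat_line t g
  else if beta == 1%E then heat_robin alpha t g
  else heat_neumann t g.

End Spaces.

(* Main.v *)
Require Import Defs.
From HB Require Import structures.
From mathcomp Require Import all_boot all_order all_algebra.
From mathcomp Require Import all_classical all_reals all_analysis.
From mathcomp Require Import measurable_realfun ring lra.
Import Order.TTheory GRing.Theory Num.Theory.
Import numFieldNormedType.Exports.
Local Open Scope ring_scope.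
Local Open Scope classical_set_scope.

(** With [s = sqrt t] and [gauss] the heat kernel at time 1, the substitution
    [y = x + s xi] turns the heat semigroup of the line into a Gaussian average
    [gavg s P x], the integral over [xi] of [gauss xi * P (x + s xi)].  This
    formula no longer degenerates at [s = 0], where it gives back [P x]: the
    continuity of the energy at [t = 0] and at [t > 0] is one and the same
    statement.  The proof writes the gradient of [T_t H] at every [x != 0] as
    [G s x], where [G] is built from Gaussian averages of functions [P] that
    are continuous away from [0] and bounded by a multiple of [1 / (1 + y^2)].

    Two facts about [gavg] then give the theorem.  By dominated convergence
    [gavg s P x] is jointly continuous at every [(s, x) != (0, 0)]: for given
    [(s, x)] the discontinuity of [P] at the origin is met by at most one [xi]
    ([gavg_cvg]).  By Peetre's inequality the bound [1 / (1 + x^2)] survives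
    averaging, uniformly for bounded [s] ([gavg_decaying]).  Hence
    [G s x ^ 2] is continuous in [s] and dominated by an integrable function
    of [x], and its integral is continuous in [s] ([sqint_continuous],
    [energy_continuous]).

    It remains to find [G].  On the line it is the average of [H'].  For
    [beta > 1] each half-line evolves as the even extension of its own data,
    so [G] averages the odd extension of [H'].  Such an extension has a kink
    at [0], but a Lipschitz function that is differentiable off one point can
    still be differentiated under the average ([gavg_is_derive]).

    For [beta = 1] the even part of [H] evolves as on the line.  The odd part
    [o] is governed, on [x > 0], by its Robin defect [2 alpha o - o']: the
    inner integral in the definition of the semigroup is, after an integration
    by parts against the Gaussian ([gavg_stein]), the heat evolution [w] of the
    odd extension of that defect ([robin_kernelE]), and the outer integral
    solves [v' = 2 alpha v - w] with [v] bounded ([resolv_is_derive]).  So the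
    gradient is again expressed by averages and stays regular as [t] goes to
    [0].  Its value at [0] is [2 alpha v(0+)]; at [t = 0] this is
    [alpha (H(0+) - H(0-))] ([lderiv0_jump]), which the boundary condition on
    [H] identifies with [H'(0+)]. *)

Set Implicit Arguments.
Unset Strict Implicit.

(** * Affine changes of variable *)
Section ChangeOfVariables.
Context {R : realType}.
Local Notation mu := (@lebesgue_measure R).
Implicit Types (D : set R) (f g : R -> R).

Definition continuous_off0 f := forall y : R, y != 0 -> {for y, continuous f}.

Lemma measurable_off0 f : continuous_off0 f -> measurable_fun setT f.
Proof.
move=> cf.
have -> : [set: R] = [set 0] `|` ~` [set 0] by rewrite setUv.
apply/measurable_funU => //; first exact: measurableC.
split; first exact: measurable_fun_set1.
apply: open_continuous_measurable_fun; first exact/closed_openC/closed_eq.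
by move=> y; rewrite inE /= => /eqP/cf.
Qed.

Lemma measurable_affine (a b : R) : measurable_fun setT (fun x : R => a * x + b).
Proof. by apply: measurable_funD => //; exact: measurable_funM. Qed.

Let affm (a b : R) : {measure set (measurableTypeR R) -> \bar R} :=
  mscale (NngNum (normr_ge0 a))
    (measure_function_pushforward__canonical__measure_function_Measure
       mu (measurable_affine a b : measurable_fun setT (_ : measurableTypeR R -> measurableTypeR R))).

(** A measure on the line is determined by its values on half-open intervals,
    and there the scaling is an explicit computation. *)
Lemma lebesgue_measure_affine (a b : R) (A : set R) : a != 0 -> measurable A ->
  mu A = (`|a|%:E * mu ((fun x => a * x + b)%R @^-1` A))%E.
Proof.
move=> a0 mA; rewrite -[RHS]/(affm a b A).
apply: lebesgue_measure_unique => // X [[p q] _ <-]/=.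
rewrite /affm /= /mscale/= /pushforward.
rewrite lebesgue_measure_itv/=.
have [an|an|/eqP] := ltgtP a 0; last by rewrite (negbTE a0).
- rewrite (_ : _ @^-1` _ = `[(q - b) / a, (p - b) / a[%classic); last first.
    apply/seteqP; split=> x /=; rewrite !in_itv/= ler_ndivrMr// ltr_ndivlMr//;
      move=> /andP[? ?]; apply/andP; lra.
  rewrite lebesgue_measure_itv/= !lte_fin ltr_ndivrMr// divfK ?lt_eqF// ltrD2r.
  case: ifPn => _; last by rewrite mule0.
  by rewrite -!EFinB -EFinM ltr0_norm//; congr EFin; field.
- rewrite (_ : _ @^-1` _ = `](p - b) / a, (q - b) / a]%classic); last first.
    apply/seteqP; split=> x /=; rewrite !in_itv/= ltr_pdivrMr// ler_pdivlMr//;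
      move=> /andP[? ?]; apply/andP; lra.
  rewrite lebesgue_measure_itv/= !lte_fin ltr_pdivrMr// divfK ?gt_eqF// ltrD2r.
  case: ifPn => _; last by rewrite mule0.
  by rewrite -!EFinB -EFinM gtr0_norm//; congr EFin; field.
Qed.

Lemma ge0_integral_affine (a b : R) D (f : R -> \bar R) : a != 0 ->
  measurable D -> measurable_fun D f -> (forall x, D x -> 0 <= f x)%E ->
  (\int[mu]_(x in D) f x =
   `|a|%:E * \int[mu]_(x in (fun x => a * x + b)%R @^-1` D) f (a * x + b)%R)%E.
Proof.
move=> a0 mD mf f0; rewrite (eq_measure_integral (affm a b)); last first.
  by move=> A mA _; exact: lebesgue_measure_affine.
rewrite ge0_integral_mscale//=; congr (_ * _)%E.
rewrite ge0_integral_pushforward//; first exact: measurable_affine.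
by move=> y; rewrite inE; exact: f0.
Qed.

(** When the positive or the negative part has infinite integral, both sides are
    the default value [0]. *)
Lemma Rintegral_affine (a b : R) D f : a != 0 ->
  measurable D -> measurable_fun D f ->
  \int[mu]_(x in D) f x =
  `|a| * \int[mu]_(x in (fun x => a * x + b) @^-1` D) f (a * x + b).
Proof.
move=> a0 mD /measurable_EFinP mf; rewrite /Rintegral integralE [in RHS]integralE.
rewrite (@ge0_integral_affine a b _ _ a0 mD (measurable_funepos mf))//.
rewrite (@ge0_integral_affine a b _ _ a0 mD (measurable_funeneg mf))//.
set pre : set R := (_ @^-1` D).
have -> : (\int[mu]_(x in pre) (fun x => (f (a * x + b)%R)%:E)^\+ x =
           \int[mu]_(x in pre) (EFin \o f)^\+ (a * x + b)%R)%E.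
  by apply: eq_integral => x _; rewrite !funeposE.
have -> : (\int[mu]_(x in pre) (fun x => (f (a * x + b)%R)%:E)^\- x =
           \int[mu]_(x in pre) (EFin \o f)^\- (a * x + b)%R)%E.
  by apply: eq_integral => x _; rewrite !funenegE.
set A := (\int[_]_(x in _) _)%E; set B := (\int[_]_(x in _) _)%E.
have A0 : (0 <= A)%E by exact: integral_ge0.
have B0 : (0 <= B)%E by exact: integral_ge0.
have na : 0 < `|a| by rewrite normr_gt0.
case: A A0 => [r| |]// _; case: B B0 => [s| |]// _ /=; first by rewrite mulrBr.
- by rewrite gt0_muley ?lte_fin//= mulr0.
- by rewrite gt0_muley ?lte_fin//= mulr0.
- by rewrite gt0_muley ?lte_fin//= mulr0.
Qed.

Lemma integrable_affine (a b : R) f : a != 0 -> measurable_fun setT f ->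
  mu.-integrable setT (EFin \o (fun x => f (a * x + b))) ->
  mu.-integrable setT (EFin \o f).
Proof.
move=> a0 mf /integrableP[_ jf]; apply/integrableP; split.
  exact/measurable_EFinP.
rewrite (@ge0_integral_affine a b)//; last first.
  by apply: measurableT_comp => //; exact/measurable_EFinP.
by rewrite preimage_setT lte_mul_pinfty// lee_fin.
Qed.

End ChangeOfVariables.

(** * Dominated integrals on the line *)
Section DominatedIntegrals.
Context {R : realType}.
Local Notation mu := (@lebesgue_measure R).
Implicit Types (D : set R) (f g : R -> R).

Lemma integrable_le D f g : measurable D -> measurable_fun D f ->
  mu.-integrable D (EFin \o g) -> (forall x, D x -> `|f x| <= g x) ->
  mu.-integrable D (EFin \o f).
Proof.
move=> mD mf ig fg; apply: (@le_integrable _ _ _ mu D mD (EFin \o f) (EFin \o g)) => //.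
  exact/measurable_EFinP.
by move=> x Dx /=; rewrite lee_fin (le_trans (fg _ Dx))// ler_norm.
Qed.

Lemma normr_Rintegral_le D f g : measurable D -> measurable_fun D f ->
  mu.-integrable D (EFin \o g) -> (forall x, D x -> `|f x| <= g x) ->
  `|\int[mu]_(x in D) f x| <= \int[mu]_(x in D) g x.
Proof.
move=> mD mf ig fg; have jf := integrable_le mD mf ig fg.
apply: le_trans; first exact: (@le_normr_Rintegral _ _ _ mu D f mD jf).
apply: le_Rintegral => //.
apply: (integrable_le mD _ ig) => [|x Dx]; last by rewrite normr_id fg.
by apply: measurableT_comp => //.
Qed.

Lemma negligible_points (c d : R) (P : R -> Prop) :
  (forall x, x != c -> x != d -> P x) -> {ae mu, forall x, P x}.
Proof.
move=> h; exists ([set c] `|` [set d]); split; first exact: measurableU.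
  rewrite measureU0//; [exact: lebesgue_measure_set1|exact: lebesgue_measure_set1].
move=> x /= nP; apply: contrapT => /not_orP[/eqP xc /eqP xd].
exact/nP/h.
Qed.

(** Convergence may fail at one point [c]; the domination of the [n]-th function
    may also fail at a point [c_ n].  This is how kinks at the origin, seen from
    a base point that moves with [n], are discarded. *)
Lemma Rintegral_cvg_dominated D (f_ : nat -> R -> R) f g (c : R) (c_ : nat -> R) :
  measurable D -> (forall n, measurable_fun D (f_ n)) -> measurable_fun D f ->
  (forall x, D x -> x != c -> f_ n x @[n --> \oo] --> f x) ->
  mu.-integrable D (EFin \o g) ->
  (forall n x, D x -> x != c -> x != c_ n -> `|f_ n x| <= g x) ->
  \int[mu]_(x in D) f_ n x @[n --> \oo] --> \int[mu]_(x in D) f x.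
Proof.
move=> mD mf_ mf cf ig fg.
have [] := @dominated_convergence _ _ _ mu D mD (fun n => EFin \o f_ n)
  (EFin \o f) (EFin \o g).
- by move=> n; apply/measurable_EFinP; exact: mf_.
- by apply/measurable_EFinP.
- apply: (@negligible_points c c) => x xc _ Dx.
  by apply: cvg_EFin; [exact: nearW|exact: cf].
- exact: ig.
- apply: ae_foralln => n; apply: (@negligible_points c (c_ n)) => x xc xcn Dx.
  by rewrite lee_fin fg.
move=> jf _ cv; apply: fine_cvg; rewrite fineK//.
exact: integrable_fin_num.
Qed.

(** Read from right to left, this replaces a reflected integral over the
    half-line by an integral over the whole line. *)
Lemma Rintegral_fold f : measurable_fun setT f -> mu.-integrable setT (EFin \o f) ->
  \int[mu]_x f x = \int[mu]_(x in `[0, +oo[) (f x + f (- x)).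
Proof.
move=> mf jf.
have jN D : measurable D -> mu.-integrable D (EFin \o (fun x => f (- x))).
  move=> mD; apply: (integrableS measurableT) => //.
  apply/integrableP; split.
    apply/measurable_EFinP; exact: (measurableT_comp mf).
  move/integrableP : jf => [_]; apply: le_lt_trans.
  rewrite [leRHS](@ge0_integral_affine _ (-1) 0)//; last first.
    by apply: measurableT_comp => //; exact/measurable_EFinP.
  rewrite normrN normr1 mul1e preimage_setT.
  by under [leRHS]eq_integral do rewrite mulN1r addr0.
have TE : [set: R] = `[0, +oo[ `|` `]-oo, 0[.
  by rewrite setUC itv_setU_setT.
rewrite TE Rintegral_setU//; last 2 first.
- by rewrite -TE.
- rewrite disj_set2E; apply/eqP/seteqP; split => x //=.
  by rewrite !in_itv/= andbT => -[x0 x1]; move: (le_lt_trans x0 x1); rewrite ltxx.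
rewrite RintegralD//; [|exact: integrableS jf|exact: jN].
congr (_ + _).
rewrite (@Rintegral_affine _ (-1) 0)//; last exact: measurable_funTS.
rewrite normrN normr1 mul1r.
have -> : (fun x : R => -1 * x + 0) @^-1` `]-oo, 0[ = `]0, +oo[.
  by apply/seteqP; split => x /=; rewrite !in_itv/= mulN1r addr0 oppr_lt0 andbT.
under eq_Rintegral do rewrite mulN1r addr0.
rewrite Rintegral_itv_obnd_cbnd//.
exact: jN.
Qed.

Lemma integrable_decay : mu.-integrable setT (EFin \o (fun x : R => (1 + x ^+ 2)^-1)).
Proof.
have cd : continuous (fun x : R => (1 + x ^+ 2)^-1) by exact: continuous_oneDsqrV.
apply/integrableP; split.
  by apply/measurable_EFinP; exact: continuous_measurable_fun.
under eq_integral => x _.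
  by rewrite /= ger0_norm ?invr_ge0 ?addr_ge0 ?sqr_ge0//; over.
rewrite ge0_symfun_integralT//; last 2 first.
- by move=> x; rewrite invr_ge0 addr_ge0// sqr_ge0.
- by move=> x /=; rewrite sqrrN.
rewrite (_ : [set x | _] = `[0, +oo[%classic); last first.
  by apply/seteqP; split => x /=; rewrite in_itv/= andbT.
have := @integral0y_oneDsqr R; rewrite /oneDsqr => ->.
by rewrite -EFinM ltry.
Qed.

Lemma integrable_gaussian (a : R) : 0 < a ->
  mu.-integrable setT (EFin \o (fun x : R => expR (- (a * x ^+ 2)))).
Proof.
move=> a0; pose s := Num.sqrt (2 * a)^-1.
have a20 : 0 < (2 * a)^-1 by rewrite invr_gt0 mulr_gt0.
have s0 : s != 0 by rewrite gt_eqF// sqrtr_gt0.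
have -> : (EFin \o (fun x : R => expR (- (a * x ^+ 2)))) =
    (fun x => ((normal_peak s)^-1)%:E * (normal_pdf 0 s x)%:E)%E.
  apply/funext => x /=; rewrite normal_pdfE// /normal_fun -EFinM; congr EFin.
  rewrite mulKf ?gt_eqF ?normal_peak_gt0//.
  congr expR; rewrite subr0 /s sqr_sqrtr ?ltW//.
  by field; rewrite gt_eqF.
by apply: integrableZl => //; exact: integrable_normal_pdf.
Qed.

End DominatedIntegrals.

(** * Gaussian averages *)
Section GaussianAverage.
Context {R : realType}.
Local Notation mu := (@lebesgue_measure R).
Implicit Types (D : set R) (f g P : R -> R) (s x y : R).

Definition gauss : R -> R := heat_kernel 1.

Lemma gaussE x : gauss x = (Num.sqrt (4 * pi))^-1 * expR (- (4^-1 * x ^+ 2)).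
Proof. by rewrite /gauss /heat_kernel !mulr1 mulrC [_ / 4]mulrC mulrC. Qed.

Lemma gauss_ge0 x : 0 <= gauss x.
Proof. by rewrite mulr_ge0 ?expR_ge0// invr_ge0. Qed.

Lemma continuous_expRsqr (a : R) : continuous (fun x : R => expR (- (a * x ^+ 2))).
Proof.
move=> x; apply: (@continuous_comp _ _ _ (fun x : R => - (a * x ^+ 2)) expR).
  apply: cvgN; apply: cvgM; [exact: cvg_cst|].
  exact: exprn_continuous.
exact: continuous_expR.
Qed.

Lemma continuous_gauss : continuous gauss.
Proof.
rewrite (_ : gauss = fun x => (Num.sqrt (4 * pi))^-1 * expR (- (4^-1 * x ^+ 2))).
  by move=> x; apply: cvgM; [exact: cvg_cst|exact: continuous_expRsqr].
by apply/funext => x; rewrite gaussE.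
Qed.

Lemma measurable_gauss : measurable_fun setT gauss.
Proof. by apply: continuous_measurable_fun; exact: continuous_gauss. Qed.

Lemma gaussN x : gauss (- x) = gauss x.
Proof. by rewrite !gaussE sqrrN. Qed.

Lemma gauss_pdfE x : gauss x = normal_pdf 0 (Num.sqrt 2) x.
Proof.
have s20 : Num.sqrt 2 != 0 :> R by rewrite gt_eqF// sqrtr_gt0.
rewrite normal_pdfE// /normal_peak /normal_fun gaussE subr0 sqr_sqrtr//.
have -> : 2 * pi *+ 2 = 4 * pi :> R by ring.
by congr (_ * expR _); field.
Qed.

Lemma integrable_gauss : mu.-integrable setT (EFin \o gauss).
Proof.
rewrite (_ : gauss = normal_pdf 0 (Num.sqrt 2)); last exact/funext/gauss_pdfE.
exact: integrable_normal_pdf.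
Qed.

Lemma Rintegral_gauss : \int[mu]_x gauss x = 1.
Proof.
rewrite /Rintegral; under eq_integral do rewrite gauss_pdfE.
by rewrite integral_normal_pdf.
Qed.

(** Half of the exponent absorbs the polynomial, because [expR u >= 1 + u]. *)
Lemma gauss_poly_le x :
  (1 + x ^+ 2) * expR (- (4^-1 * x ^+ 2)) <= 8 * expR (- (8^-1 * x ^+ 2)).
Proof.
have x2 : 0 <= x ^+ 2 by exact: sqr_ge0.
have -> : - (4^-1 * x ^+ 2) = - (8^-1 * x ^+ 2) + - (8^-1 * x ^+ 2) by field.
rewrite expRD mulrA ler_wpM2r ?expR_ge0//.
rewrite -ler_pdivlMr ?expR_gt0// -expRN opprK.
have := expR_ge1Dx (8^-1 * x ^+ 2); lra.
Qed.

Lemma integrable_gauss_poly :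
  mu.-integrable setT (EFin \o (fun x => gauss x * (1 + x ^+ 2))).
Proof.
have ig : mu.-integrable setT (EFin \o (fun x : R =>
    (8 * (Num.sqrt (4 * pi))^-1) * expR (- (8^-1 * x ^+ 2)))).
  by apply: (integrableZl _ _ (integrable_gaussian _)).
apply: integrable_le ig _ => //.
  apply: measurable_funM; first exact: measurable_gauss.
  by apply: measurable_funD => //; exact: exprn_measurable.
move=> x _; rewrite ger0_norm ?mulr_ge0 ?gauss_ge0 ?addr_ge0 ?sqr_ge0//.
rewrite gaussE -!mulrA [leRHS]mulrCA ler_wpM2l ?invr_ge0//.
by rewrite mulrC gauss_poly_le.
Qed.

(** The weight [1 + x^2] is the one that Peetre's inequality produces when a
    decaying function is translated. *)
Definition gauss_moment : R := \int[mu]_x (gauss x * (1 + x ^+ 2)).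

(** The heat flow at time [s ^+ 2] of [P], written so that [s = 0] is allowed. *)
Definition gavg s P x : R := \int[mu]_xi (gauss xi * P (x + s * xi)).

Lemma gavg0 P x : gavg 0 P x = P x.
Proof.
rewrite /gavg; under eq_Rintegral do rewrite mul0r addr0.
by rewrite RintegralZr ?Rintegral_gauss ?mul1r//; exact: integrable_gauss.
Qed.

Lemma measurable_gauss_comp s P x : measurable_fun setT P ->
  measurable_fun setT (fun xi => gauss xi * P (x + s * xi)).
Proof.
move=> mP; apply: measurable_funM; first exact: measurable_gauss.
apply: (measurableT_comp mP); rewrite (_ : (fun _ => _) = fun xi : R => s * xi + x).
  exact: measurable_affine.
by apply/funext => xi; rewrite addrC.
Qed.

Lemma integrable_gauss_comp s P x K : measurable_fun setT P ->
  (forall y, `|P y| <= K) ->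
  mu.-integrable setT (EFin \o (fun xi => gauss xi * P (x + s * xi))).
Proof.
move=> mP PK.
have ig : mu.-integrable setT (EFin \o (fun x : R => K * gauss x)).
  by apply: (integrableZl _ _ integrable_gauss).
apply: integrable_le ig _ => //; first exact: measurable_gauss_comp.
by move=> xi _; rewrite normrM ger0_norm ?gauss_ge0// mulrC ler_wpM2r// gauss_ge0.
Qed.

Lemma affine_root s x xi : s != 0 -> xi != - x / s -> x + s * xi != 0.
Proof.
move=> s0; apply: contra => /eqP h; apply/eqP; have -> : x = - (s * xi) by lra.
by field.
Qed.

(** The average sees the discontinuity of [P] only at [xi = - x / s] when
    [s != 0]; when [s = 0] it evaluates [P] near [x], hence the last hypothesis. *)
Lemma gavg_cvg (s_ x_ : nat -> R) s x P K :
  continuous_off0 P -> (forall y, `|P y| <= K) ->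
  s_ n @[n --> \oo] --> s -> x_ n @[n --> \oo] --> x ->
  (s != 0) || (x != 0) ->
  gavg (s_ n) P (x_ n) @[n --> \oo] --> gavg s P x.
Proof.
move=> cP PK cs cx sx0; have mP := measurable_off0 cP.
have ig : mu.-integrable setT (EFin \o (fun x : R => K * gauss x)).
  by apply: (integrableZl _ _ integrable_gauss).
apply: (@Rintegral_cvg_dominated _ _ (fun n xi => gauss xi * P (x_ n + s_ n * xi))
  _ (fun x : R => K * gauss x) (- x / s) (fun=> 0)) => //.
- by move=> n; exact: measurable_gauss_comp.
- exact: measurable_gauss_comp.
- move=> xi _ nxi; apply: cvgM; first exact: cvg_cst.
  apply: (@cvg_comp _ _ _ (fun n => x_ n + s_ n * xi) P _ (nbhs (x + s * xi))).
    by apply: cvgD => //; apply: cvgM => //; exact: cvg_cst.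
  apply: cP; have [s0|s0] := eqVneq s 0.
    by rewrite s0 mul0r addr0; move: sx0; rewrite s0 eqxx.
  exact: affine_root.
- move=> n xi _ _ _.
  by rewrite normrM ger0_norm ?gauss_ge0// mulrC ler_wpM2r// gauss_ge0.
Qed.

Definition decaying (C : R) P := forall y, `|P y| <= C * (1 + y ^+ 2)^-1.

Lemma one_add_sqr_gt0 y : 0 < 1 + y ^+ 2 :> R.
Proof. by rewrite ltr_wpDr// sqr_ge0. Qed.

Lemma decaying_ge0 C P : decaying C P -> 0 <= C.
Proof. by move=> /(_ 0); rewrite expr0n/= addr0 invr1 mulr1; exact: le_trans. Qed.

Lemma decaying_bounded C P : decaying C P -> forall y, `|P y| <= C.
Proof.
move=> dP y; apply: (le_trans (dP y)); rewrite ler_piMr ?(decaying_ge0 dP)//.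
by rewrite invf_le1 ?one_add_sqr_gt0// lerDl sqr_ge0.
Qed.

(** Peetre's inequality: a translation by [y] costs a factor [2 (1 + y^2)]. *)
Lemma decay_shift_le x y : (1 + (x + y) ^+ 2)^-1 <= 2 * (1 + y ^+ 2) * (1 + x ^+ 2)^-1 :> R.
Proof.
have h1 := one_add_sqr_gt0 (x + y); have h2 := one_add_sqr_gt0 x.
rewrite ler_pdivlMr// mulrC ler_pdivrMr//.
have := sqr_ge0 (x + 2 * y); have := sqr_ge0 (y * (x + y)); nra.
Qed.

(** Translating the decay of [P] back from [x + s xi] to [x] costs a factor
    quadratic in [s xi], which the Gaussian integrates. *)
Lemma gavg_decaying s C P : measurable_fun setT P -> decaying C P ->
  decaying (C * (2 * (1 + s ^+ 2) * gauss_moment)) (gavg s P).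
Proof.
move=> mP dP x; have C0 := decaying_ge0 dP.
pose B := C * (2 * (1 + s ^+ 2)) * (1 + x ^+ 2)^-1.
have ig : mu.-integrable setT (EFin \o (fun xi : R => B * (gauss xi * (1 + xi ^+ 2)))).
  by apply: (integrableZl _ _ integrable_gauss_poly).
rewrite [leRHS](_ : _ = B * gauss_moment); last by rewrite /B; ring.
rewrite /gauss_moment -RintegralZl//; last exact: integrable_gauss_poly.
apply: normr_Rintegral_le ig _ => //; first exact: measurable_gauss_comp.
move=> xi _; rewrite normrM (ger0_norm (gauss_ge0 _)) [leRHS]mulrCA.
rewrite ler_wpM2l ?gauss_ge0//; apply: (le_trans (dP _)).
rewrite (_ : B * _ = C * (2 * ((1 + s ^+ 2) * (1 + xi ^+ 2)) * (1 + x ^+ 2)^-1));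
  last by rewrite /B; ring.
rewrite ler_wpM2l// (le_trans (decay_shift_le _ _))//.
rewrite ler_wpM2r ?invr_ge0 ?(ltW (one_add_sqr_gt0 x))// ler_wpM2l//.
rewrite exprMn; have := sqr_ge0 s; have := sqr_ge0 xi; nra.
Qed.

End GaussianAverage.

(** * Differentiating a Gaussian average *)
Section Differentiation.
Context {R : realType}.
Local Notation mu := (@lebesgue_measure R).
Implicit Types (D : set R) (f g P : R -> R) (s x y : R).

Lemma is_derive_seqP f x l :
  is_derive x 1 f l <->
  (forall h : nat -> R, (forall n, h n != 0) -> h n @[n --> \oo] --> 0 ->
     (h n)^-1 * (f (x + h n) - f x) @[n --> \oo] --> l).
Proof.
have E : (fun h : R => h^-1 *: ((f \o shift x) (h *: 1) - f x)) =
    (fun h => h^-1 * (f (x + h) - f x)).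
  by apply: funext => h; rewrite /= /GRing.scale/= mulr1 (addrC x).
split=> [[df fl] h h0 ch|hl].
  move: df fl; rewrite /derivable /derive E => df fl.
  have : h^-1 * (f (x + h) - f x) @[h --> 0^'] --> l by rewrite -fl.
  by move=> /cvgr_dnbhsP /(_ h); apply.
have : h^-1 * (f (x + h) - f x) @[h --> 0^'] --> l.
  by apply/cvgr_dnbhsP => u [u0 cu]; exact: hl.
by rewrite -E => cl; apply: DeriveDef; [apply/cvg_ex; exists l|exact/cvg_lim].
Qed.

Lemma is_derive_continuous f x l : is_derive x 1 f l -> {for x, continuous f}.
Proof. by case=> df _; exact/differentiable_continuous/derivable1_diffP. Qed.

Lemma mean_value_le f P (K a b : R) : a <= b ->
  (forall x, a <= x <= b -> is_derive x 1 f (P x)) ->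
  (forall x, a <= x <= b -> `|P x| <= K) ->
  `|f b - f a| <= K * (b - a).
Proof.
move=> ab df PK.
have [||c cab ->] := @MVT_segment R f P a b ab.
- move=> x; rewrite in_itv/= => /andP[ax xb]; apply: df.
  by rewrite !ltW.
- apply: continuous_in_subspaceT => x; rewrite inE/= in_itv/= => axb.
  exact: (is_derive_continuous (df _ axb)).
rewrite normrM (ger0_norm (x := b - a)) ?subr_ge0// ler_wpM2r ?subr_ge0//.
by apply: PK; rewrite in_itv/= in cab.
Qed.

(** The origin is excluded so that the value there may be arbitrary. *)
Definition lipschitz_off0 (K : R) g :=
  forall a b : R, a != 0 -> b != 0 -> `|g a - g b| <= K * `|a - b|.

Lemma lipschitz_smooth g P (K : R) : (forall y, is_derive y 1 g (P y)) ->
  (forall y, `|P y| <= K) -> lipschitz_off0 K g.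
Proof.
move=> dg PK a b _ _; wlog ab : a b / b <= a.
  move=> wl; have [|/ltW] := leP b a; first exact: wl.
  by move=> /wl; rewrite distrC [`|b - a|]distrC.
by rewrite [`|a - b|]ger0_norm ?subr_ge0//; apply: (mean_value_le ab).
Qed.

(** A kink at the origin of an even function is harmless: both values are read
    off on the positive half-line, and [| |a| - |b| | <= |a - b|]. *)
Lemma lipschitz_even g P (K : R) : (forall y, g (- y) = g y) ->
  (forall y, 0 < y -> is_derive y 1 g (P y)) ->
  (forall y, `|P y| <= K) -> lipschitz_off0 K g.
Proof.
move=> eg dg PK.
have K0 : 0 <= K by apply: le_trans (PK 0).
have hpos a b : 0 < b -> b <= a -> `|g a - g b| <= K * `|a - b|.
  move=> b0 ba; rewrite [`|a - b|]ger0_norm ?subr_ge0//.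
  apply: (mean_value_le ba) => // x /andP[bx _]; apply: dg; exact: lt_le_trans bx.
have gabs a : g `|a| = g a by case: (ger0P a).
move=> a b a0 b0; rewrite -(gabs a) -(gabs b).
apply: (@le_trans _ _ (K * `| `|a| - `|b| |)); last first.
  by rewrite ler_wpM2l// ler_dist_dist.
have pa : 0 < `|a| by rewrite normr_gt0.
have pb : 0 < `|b| by rewrite normr_gt0.
have [|/ltW] := leP `|b| `|a|; first exact: hpos.
by move=> /(hpos _ _ pa); rewrite distrC [`| `|b| - _|]distrC.
Qed.

(** The difference quotients of [g] are bounded by [K] and converge to [P]
    except where [x + s xi = 0], so dominated convergence applies. *)
Lemma gavg_is_derive s g P (B K : R) x : s != 0 ->
  measurable_fun setT g -> (forall y, `|g y| <= B) -> lipschitz_off0 K g ->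
  measurable_fun setT P -> (forall y, y != 0 -> is_derive y 1 g (P y)) ->
  is_derive x 1 (gavg s g) (gavg s P x).
Proof.
move=> s0 mg gB gK mP dg; apply/is_derive_seqP => h h0 ch.
have ig : mu.-integrable setT (EFin \o (fun x : R => K * gauss x)).
  by apply: (integrableZl _ _ integrable_gauss).
have ic y := integrable_gauss_comp s y mg gB.
have -> : (fun n => (h n)^-1 * (gavg s g (x + h n) - gavg s g x)) =
  fun n => \int[mu]_xi ((h n)^-1 * (gauss xi * g (x + h n + s * xi)
                                    - gauss xi * g (x + s * xi))).
  apply/funext => n; rewrite RintegralZl//; last exact: (integrableB _ (ic _) (ic _)).
  by rewrite RintegralB.
apply: (@Rintegral_cvg_dominated _ _ _ _ (fun x : R => K * gauss x) (- x / s)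
  (fun n => - (x + h n) / s)) => //.
- move=> n; apply: measurable_funM => //.
  by apply: measurable_funB; exact: measurable_gauss_comp.
- exact: measurable_gauss_comp.
- move=> xi _ /(affine_root s0) nx.
  have -> : (fun n => (h n)^-1 * (gauss xi * g (x + h n + s * xi)
      - gauss xi * g (x + s * xi))) =
    (fun n => gauss xi * ((h n)^-1 * (g (x + s * xi + h n) - g (x + s * xi)))).
    by apply/funext => n; rewrite -mulrBr mulrCA addrAC.
  apply: cvgM; first exact: cvg_cst.
  exact: ((is_derive_seqP _ _ _).1 (dg _ nx)).
- move=> n xi _ /(affine_root s0) nx /(affine_root s0) nxh.
  rewrite -mulrBr mulrCA normrM ger0_norm ?gauss_ge0// mulrC.
  rewrite ler_wpM2r ?gauss_ge0// normrM normfV mulrC ler_pdivrMr ?normr_gt0//.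
  apply: (le_trans (gK _ _ nxh nx)).
  by rewrite (_ : x + h n + _ - _ = h n)//; ring.
Qed.

Lemma is_derive_gauss x : is_derive x 1 gauss (- (x / 2) * gauss x).
Proof.
have E : gauss = (Num.sqrt (4 * pi))^-1 \*: (fun x => expR (- (4^-1 * x ^+ 2))).
  by apply/funext => y; rewrite gaussE.
have dq : is_derive x 1 (fun x : R => - (4^-1 * x ^+ 2)) (- (4^-1 * (2 * x))).
  have -> : (fun x : R => - (4^-1 * x ^+ 2)) = - (4^-1 \*: (id ^+ 2)) by [].
  apply: is_deriveN; apply: is_deriveZ.
  apply: (is_derive_eq (is_deriveX 2 (is_derive_id _ _))).
  by rewrite /= expr1 [LHS]mulr1.
have dg : is_derive x 1 gauss ((Num.sqrt (4 * pi))^-1 *: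
   (expR (- (4^-1 * x ^+ 2)) * (- (4^-1 * (2 * x))))).
  by rewrite E; apply: is_deriveZ; exact: (is_derive1_comp _ dq).
apply: (is_derive_eq dg).
rewrite gaussE /GRing.scale/=; field.
by rewrite gt_eqF// sqrtr_gt0 mulr_gt0// pi_gt0.
Qed.

End Differentiation.

(** * Integration by parts against the Gaussian *)
Section Stein.
Context {R : realType}.
Local Notation mu := (@lebesgue_measure R).
Implicit Types (D : set R) (f g P : R -> R) (s x y : R).

(** The slope of the Gaussian at [xi - k] is dominated by a wider Gaussian in
    [xi], uniformly for small shifts; this is what differentiation under the
    integral requires. *)
Lemma gauss_slope_le (xi k : R) : `|k| <= 1 ->
  `|(xi - k) / 2 * gauss (xi - k)| <=
  (Num.sqrt (4 * pi))^-1 * (2 * expR 8^-1 * expR (- (16^-1 * xi ^+ 2))).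
Proof.
move=> k1; rewrite normrM [`|gauss _|]ger0_norm ?gauss_ge0// gaussE mulrCA.
rewrite ler_wpM2l ?invr_ge0//.
set eta := xi - k.
apply: (@le_trans _ _ (2 * expR (- (8^-1 * eta ^+ 2)))).
  have h := gauss_poly_le eta.
  have e0 : 0 <= expR (- (4^-1 * eta ^+ 2)) by exact: expR_ge0.
  have : `|eta / 2| <= (1 + eta ^+ 2) / 4.
    rewrite ler_norml; have := sqr_ge0 (eta - 1); have := sqr_ge0 (eta + 1).
    by move=> ? ?; apply/andP; split; lra.
  move=> /(ler_wpM2r e0) /le_trans; apply; lra.
rewrite -mulrA -expRD ler_wpM2l// ler_expR.
have : k ^+ 2 <= 1.
  move: k1; rewrite ler_norml => /andP[? ?].
  have : 0 <= (1 - k) * (1 + k) by rewrite mulr_ge0//; lra.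
  lra.
have := sqr_ge0 (xi - 2 * k); rewrite /eta; nra.
Qed.

(** Stein's identity.  The derivative of [gavg s g] can be computed by moving
    [g], which gives the left-hand side, or, after a translation of [xi], by
    moving the Gaussian, which gives the right-hand side.  Comparing the two
    replaces an integration by parts that would have to cut the line at the
    kink of [g]. *)
Lemma gavg_stein s g P (B K : R) x : s != 0 ->
  measurable_fun setT g -> (forall y, `|g y| <= B) -> lipschitz_off0 K g ->
  measurable_fun setT P -> (forall y, y != 0 -> is_derive y 1 g (P y)) ->
  gavg s P x = \int[mu]_xi (xi / 2 * gauss xi * s^-1 * g (x + s * xi)).
Proof.
move=> s0 mg gB gK mP dg.
have dG := gavg_is_derive x s0 mg gB gK mP dg.
(* The dependence on y is carried by the Gaussian alone. *)
pose f y xi := gauss (xi - (y - x) / s) * g (x + s * xi).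
pose df y xi := (xi - (y - x) / s) / 2 * gauss (xi - (y - x) / s) * s^-1 * g (x + s * xi).
have fE : gavg s g = fun y => \int[mu]_xi f y xi.
  apply/funext => y; rewrite /gavg (@Rintegral_affine _ 1 (- ((y - x) / s)))//;
    last exact: measurable_gauss_comp.
  rewrite normr1 mul1r preimage_setT; apply: eq_Rintegral => xi _.
  by rewrite mul1r /f; congr (_ * g _); field.
have ms : measurable_fun setT (fun xi => g (x + s * xi)).
  apply: (measurableT_comp mg); rewrite (_ : (fun _ => _) = fun xi : R => s * xi + x).
    exact: measurable_affine.
  by apply/funext => xi; rewrite addrC.
have intf y : mu.-integrable setT (EFin \o f y).
  apply: (@integrable_affine _ 1 ((y - x) / s)) => //.
    apply: measurable_funM => //; apply: (measurableT_comp measurable_gauss).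
    by apply: measurable_funB.
  rewrite (_ : (fun _ => _) = fun xi => gauss xi * g (y + s * xi)).
    exact: integrable_gauss_comp mg gB.
  by apply/funext => xi; rewrite /f mul1r addrK; congr (_ * g _); field.
have dfE y xi : is_derive y 1 (f ^~ xi) (df y xi).
  have dl : is_derive y 1 (fun y => xi - (y - x) / s) (- s^-1).
    rewrite (_ : (fun _ => _) = cst xi - (s^-1 \*: (id - cst x))).
      apply: (is_derive_eq (is_deriveB (is_derive_cst _ _ _)
        (is_deriveZ _ (is_deriveB (is_derive_id _ _) (is_derive_cst _ _ _))))).
      by rewrite subr0 sub0r [_ *: _]mulr1.
    by apply/funext => z /=; rewrite [in LHS]mulrC.
  rewrite (_ : f ^~ xi = g (x + s * xi) \*: (gauss \o (fun y => xi - (y - x) / s))); last first.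
    by apply/funext => z; rewrite /f mulrC.
  apply: (is_derive_eq (is_deriveZ _ (is_derive1_comp (is_derive_gauss _) dl))).
  by rewrite /df /GRing.scale/=; ring.
have -> : gavg s P x = (gavg s g)^`() x by rewrite derive1E; apply/esym/derive_val.
rewrite fE.
pose G xi : R := `|s|^-1 * B * (Num.sqrt (4 * pi))^-1 * (2 * expR 8^-1) * expR (- (16^-1 * xi ^+ 2)).
have iG : mu.-integrable setT (EFin \o G).
  apply: (integrableZl _ _ (integrable_gaussian _)) => //.
have as0 : 0 < `|s| by rewrite normr_gt0.
have B0 : 0 <= B by apply: le_trans (gB 0).
rewrite (@differentiation_under_integral _ _ (measurableTypeR R) mu f setT _ x (x - `|s|) (x + `|s|) _ _ _ G)//.
- apply: eq_Rintegral => xi _; rewrite partial1of2E (derive_val (is_derive := dfE _ _)).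
  by rewrite /df subrr mul0r subr0.
- by rewrite /= in_itv/=; apply/andP; split; lra.
- by move=> xi; rewrite /G !mulr_ge0 ?expR_ge0 ?invr_ge0 ?sqrtr_ge0//.
- move=> y xi /=; rewrite in_itv/= => /andP[y1 y2] _.
  rewrite partial1of2E (derive_val (is_derive := dfE _ _)).
  rewrite /df normrM normrM normfV.
  have k1 : `|(y - x) / s| <= 1.
    by rewrite normrM normfV ler_pdivrMr// mul1r ler_norml; apply/andP; split; lra.
  have h := gauss_slope_le xi k1.
  rewrite /G (_ : _ * _ * _ * _ * _ = (Num.sqrt (4 * pi))^-1 *
    (2 * expR 8^-1 * expR (- (16^-1 * xi ^+ 2))) * `|s|^-1 * B); last by ring.
  by rewrite ler_pM// ?mulr_ge0 ?invr_ge0// ler_wpM2r ?invr_ge0.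
Qed.

End Stein.

(** * Heat kernels as Gaussian averages *)
Section Kernels.
Context {R : realType}.
Local Notation mu := (@lebesgue_measure R).
Implicit Types (D : set R) (f g P : R -> R) (s x y z : R).

Lemma is_derive_comp_opp f y l : is_derive (- y) 1 f l ->
  is_derive y 1 (fun x => f (- x)) (- l).
Proof.
move=> df; have := is_derive1_comp (g := -%R) (x := y) df (is_deriveNid _ _).
by rewrite mulrN1.
Qed.

Lemma is_derive_comp_norm f P y : (forall x, 0 < x -> is_derive x 1 f (P x)) ->
  y != 0 -> is_derive y 1 (fun x => f `|x|) (Num.sg y * P `|y|).
Proof.
move=> df; case: (ltgtP y 0) => // y0 _.
- rewrite ltr0_sg// ltr0_norm// mulN1r.
  apply: near_eq_is_derive (is_derive_comp_opp (df _ _)); last by rewrite oppr_gt0.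
  near=> x; rewrite ltr0_norm//; near: x; exact: lt_nbhsl.
- rewrite gtr0_sg// gtr0_norm// mul1r.
  apply: near_eq_is_derive (df _ y0).
  near=> x; rewrite gtr0_norm//; near: x; exact: lt_nbhsr.
Unshelve. all: by end_near. Qed.

Lemma heat_kernelN t x : heat_kernel t (- x) = heat_kernel t x.
Proof. by rewrite /heat_kernel sqrrN. Qed.

Lemma heat_kernel_scale s x : 0 < s ->
  heat_kernel (s ^+ 2) (s * x) = s^-1 * gauss x.
Proof.
move=> s0; rewrite /heat_kernel gaussE [RHS]mulrA -invfM; congr (_^-1 * expR _).
  by rewrite sqrtrM ?mulr_ge0 ?pi_ge0// sqrtr_sqr gtr0_norm// mulrC.
by field; rewrite gt_eqF.
Qed.

Lemma measurable_abs : measurable_fun setT (fun y : R => `|y|).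
Proof. by apply: continuous_measurable_fun; exact: norm_continuous. Qed.

Lemma measurable_heat_kernel t x : measurable_fun setT (fun y => heat_kernel t (x - y)).
Proof.
apply: measurable_funM => //; apply: (measurableT_comp (@measurable_expR R)).
apply: measurableT_comp => //; apply: measurable_funM => //.
by apply: measurable_funX; apply: measurable_funB.
Qed.

(** The substitution [y = x + s xi]; the factor [s] of the Lebesgue measure
    cancels the normalisation of the kernel. *)
Lemma heat_convolution s m x : 0 < s -> measurable_fun setT m ->
  mu.-integrable setT (EFin \o (fun xi => gauss xi * m (x + s * xi))) ->
  mu.-integrable setT (EFin \o (fun y => heat_kernel (s ^+ 2) (x - y) * m y)) /\
  \int[mu]_y (heat_kernel (s ^+ 2) (x - y) * m y) =
  \int[mu]_xi (gauss xi * m (x + s * xi)).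
Proof.
move=> s0 mm jm; have sn0 : s != 0 by rewrite gt_eqF.
have mF : measurable_fun setT (fun y => heat_kernel (s ^+ 2) (x - y) * m y).
  by apply: measurable_funM => //; exact: measurable_heat_kernel.
have E : (fun xi => heat_kernel (s ^+ 2) (x - (s * xi + x)) * m (s * xi + x)) =
    (fun xi => s^-1 * (gauss xi * m (x + s * xi))).
  apply/funext => xi; rewrite [x - _](_ : _ = - (s * xi)); last by ring.
  by rewrite heat_kernelN heat_kernel_scale// [RHS]mulrA (addrC x).
split.
  apply: (integrable_affine sn0 (b := x)) => //; rewrite E.
  by apply: (integrableZl _ _ jm).
rewrite (Rintegral_affine x sn0)// preimage_setT.
rewrite (_ : (\int[_]_(_ in _) _) = \int[mu]_xi (s^-1 * (gauss xi * m (x + s * xi)))).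
  by rewrite RintegralZl// gtr0_norm// mulVKf.
by apply: eq_Rintegral => xi _; exact: (congr1 (@^~ xi) E).
Qed.

Lemma heat_lineE s g (B : R) x : 0 < s -> measurable_fun setT g -> (forall y, `|g y| <= B) ->
  heat_line (s ^+ 2) g x = gavg s g x.
Proof.
by move=> s0 mg gB; have [] := heat_convolution s0 mg (integrable_gauss_comp s x mg gB).
Qed.

(** The method of images: reflecting the kernel amounts to extending the data
    of the half-line of [x] evenly. *)
Lemma heat_neumannE s g (B : R) x : 0 < s -> measurable_fun setT g ->
  (forall y, `|g y| <= B) ->
  heat_neumann (s ^+ 2) g x = gavg s (fun y => g (`|y| * sign x)) x.
Proof.
move=> s0 mg gB.
have mg' : measurable_fun setT (fun y => g (`|y| * sign x)).
  apply: (measurableT_comp mg); apply: measurable_funM => //.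
have [jF EF] := heat_convolution s0 mg'
  (integrable_gauss_comp s x mg' (fun y => gB (`|y| * sign x))).
rewrite [RHS]/gavg -EF Rintegral_fold//; last first.
  by apply: measurable_funM => //; exact: measurable_heat_kernel.
apply: eq_Rintegral => y; rewrite inE/= in_itv/= andbT => y0.
by rewrite opprK normrN ger0_norm// mulrDl.
Qed.

(** The singular factors [(z - y) / (2 t)] and [(z + y) / (2 t)] are slopes of
    the heat kernel.  Folding them back onto the line pairs them with the even
    function [o |y|], and Stein's identity moves the slope onto that function;
    the remaining terms pair the kernel with the odd function [2 alpha o]. *)
Lemma robin_kernelE (alpha s : R) (o E : R -> R) (B K : R) z : 0 < s ->
  (forall y, o (- y) = - o y) -> measurable_fun setT o -> (forall y, `|o y| <= B) ->
  lipschitz_off0 K (fun y => o `|y|) ->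
  measurable_fun setT E -> (forall y, `|E y| <= K) ->
  (forall y, y != 0 -> is_derive y 1 (fun y => o `|y|) (E y)) ->
  \int[mu]_(y in `[0, +oo[)
    (((z - y + 4 * alpha * s ^+ 2) / (2 * s ^+ 2) * heat_kernel (s ^+ 2) (z - y)
      + (z + y - 4 * alpha * s ^+ 2) / (2 * s ^+ 2) * heat_kernel (s ^+ 2) (z + y)) * o y)
  = gavg s (fun y => 2 * alpha * o y - E y) z.
Proof.
move=> s0 oo mo oB oK mE EK dE; have sn0 : s != 0 by rewrite gt_eqF.
have me : measurable_fun setT (fun y => o `|y|).
  by apply: (measurableT_comp mo); exact: measurable_abs.
have eB y : `|o `|y| | <= B by [].
pose m y := (z - y) / (2 * s ^+ 2) * o `|y| + 2 * alpha * o y.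
have mm : measurable_fun setT m.
  apply: measurable_funD; last exact: measurable_funM.
  by do 2 apply: measurable_funM => //; apply: measurable_funB.
have jo := integrable_gauss_comp s z mo oB.
have jE := integrable_gauss_comp s z mE EK.
have jS : mu.-integrable setT (EFin \o (fun xi => xi / 2 * gauss xi * s^-1 * o `|z + s * xi|)).
  have ig : mu.-integrable setT (EFin \o (fun xi : R =>
      (s^-1 * B) * (gauss xi * (1 + xi ^+ 2)))).
    by apply: (integrableZl _ _ integrable_gauss_poly).
  apply: integrable_le ig _ => //.
    apply: measurable_funM.
      by do 2 apply: measurable_funM => //; [apply: measurable_funM|exact: measurable_gauss].
    apply: (measurableT_comp me); rewrite (_ : (fun _ => _) = fun xi : R => s * xi + z).
      exact: measurable_affine.
    by apply/funext => xi; rewrite addrC.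
  have is0 : 0 <= s^-1 by rewrite invr_ge0 ltW.
  move=> xi _; have B0 : 0 <= B by apply: le_trans (oB 0).
  rewrite normrM [leRHS](_ : _ = ((1 + xi ^+ 2) * gauss xi * s^-1) * B); last by ring.
  apply: ler_pM => //.
  rewrite normrM [`|xi / 2 * _|]normrM (ger0_norm (gauss_ge0 _)) (gtr0_norm (x := s^-1)) ?invr_gt0//.
  rewrite (ler_wpM2r is0)// (ler_wpM2r (gauss_ge0 _))// ler_norml.
  by have := sqr_ge0 (xi - 1); have := sqr_ge0 (xi + 1); move=> ? ?; apply/andP; split; lra.
have E1 : (fun xi => gauss xi * m (z + s * xi)) = (fun xi =>
    2 * alpha * (gauss xi * o (z + s * xi)) - xi / 2 * gauss xi * s^-1 * o `|z + s * xi|).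
  by apply/funext => xi; rewrite /m; field.
have jo' : mu.-integrable setT (EFin \o (fun xi => 2 * alpha * (gauss xi * o (z + s * xi)))).
  by apply: (integrableZl _ _ jo).
have jm : mu.-integrable setT (EFin \o (fun xi => gauss xi * m (z + s * xi))).
  by rewrite E1; apply: (integrableB _ jo' jS).
have [jF EF] := heat_convolution s0 mm jm.
transitivity (\int[mu]_y (heat_kernel (s ^+ 2) (z - y) * m y)).
  rewrite Rintegral_fold//; last first.
    by apply: measurable_funM => //; exact: measurable_heat_kernel.
  apply: eq_Rintegral => y; rewrite inE/= in_itv/= andbT => y0.
  by rewrite /m opprK normrN ger0_norm// oo; field.
rewrite EF E1 RintegralB// RintegralZl//.
rewrite -(gavg_stein z sn0 me eB oK mE dE).
rewrite -RintegralZl// /gavg -RintegralB//.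
by apply: eq_Rintegral => xi _; ring.
Qed.

End Kernels.

(** * Bounded solutions of a first order equation on a half-line *)
Section Resolvent.
Context {R : realType}.
Local Notation mu := (@lebesgue_measure R).
Implicit Types (f g P w k : R -> R) (s x y z a : R).

(** The bounded solution [v] of [v' = a v - w] on the half-line. *)
Definition resolv a w x : R :=
  \int[mu]_(r in `[0, +oo[) (expR (- (a * r)) * w (x + r)).

Definition exp_mass a : R := \int[mu]_(r in `[0, +oo[) expR (- (a * r)).

Lemma continuous_expRN a : continuous (fun r : R => expR (- (a * r))).
Proof.
move=> x; apply: (@continuous_comp _ _ _ (fun r : R => - (a * r)) expR).
  by apply: cvgN; apply: cvgM; [exact: cvg_cst|exact: cvg_id].
exact: continuous_expR.
Qed.

Lemma measurable_expRN a : measurable_fun setT (fun r : R => expR (- (a * r))).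
Proof. by apply: continuous_measurable_fun; exact: continuous_expRN. Qed.

Lemma integrable_expRN a : 0 < a ->
  mu.-integrable `[0, +oo[ (EFin \o (fun r => expR (- (a * r)))).
Proof.
move=> a0.
have ig : mu.-integrable `[0, +oo[ (EFin \o (fun r => a^-1 * exponential_pdf a r)).
  apply: (integrableS measurableT) => //.
  by apply: (integrableZl _ _ (integrable_exponential_pdf a0)).
apply: integrable_le ig _ => //; first by apply: measurable_funTS; exact: measurable_expRN.
move=> r /=; rewrite in_itv/= andbT => r0.
by rewrite exponential_pdfE// mulKf ?gt_eqF// ger0_norm ?expR_ge0// mulNr.
Qed.

Lemma measurable_resolv a w x : measurable_fun setT w ->
  measurable_fun (`[0, +oo[%classic : set R) (fun r : R => expR (- (a * r)) * w (x + r)).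
Proof.
move=> mw; apply: measurable_funTS; apply: measurable_funM.
  exact: measurable_expRN.
by apply: (measurableT_comp mw); apply: measurable_funD.
Qed.

Lemma resolv_cvg a (w_ : nat -> R -> R) (x_ : nat -> R) w x (K c : R) : 0 < a ->
  (forall n, measurable_fun setT (w_ n)) -> measurable_fun setT w ->
  (forall n y, `|w_ n y| <= K) ->
  (forall r, 0 <= r -> r != c -> w_ n (x_ n + r) @[n --> \oo] --> w (x + r)) ->
  resolv a (w_ n) (x_ n) @[n --> \oo] --> resolv a w x.
Proof.
move=> a0 mw_ mw wK cw.
have ig : mu.-integrable `[0, +oo[ (EFin \o (fun r : R => K * expR (- (a * r)))).
  by apply: (integrableZl _ _ (integrable_expRN a0)).
apply: (@Rintegral_cvg_dominated _ _ (fun n r => expR (- (a * r)) * w_ n (x_ n + r))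
  _ (fun r : R => K * expR (- (a * r))) c (fun=> 0)) => //.
- by move=> n; exact: measurable_resolv.
- exact: measurable_resolv.
- move=> r /=; rewrite in_itv/= andbT => r0 rc.
  by apply: cvgM; [exact: cvg_cst|exact: cw].
- move=> n r _ _ _.
  by rewrite normrM ger0_norm ?expR_ge0// mulrC ler_wpM2r// expR_ge0.
Qed.

Lemma resolv_le a w x (K : R) : 0 < a -> measurable_fun setT w ->
  (forall r, 0 <= r -> `|w (x + r)| <= K) ->
  `|resolv a w x| <= K * exp_mass a.
Proof.
move=> a0 mw wK.
have ig : mu.-integrable `[0, +oo[ (EFin \o (fun r : R => K * expR (- (a * r)))).
  by apply: (integrableZl _ _ (integrable_expRN a0)).
rewrite /exp_mass -RintegralZl//; last exact: integrable_expRN.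
apply: normr_Rintegral_le ig _ => //; first exact: measurable_resolv.
move=> r /=; rewrite in_itv/= andbT => r0.
by rewrite normrM ger0_norm ?expR_ge0// mulrC ler_wpM2r ?expR_ge0// wK.
Qed.

Lemma resolv_tailE a w x (K : R) : 0 < a -> measurable_fun setT w ->
  (forall y, `|w y| <= K) ->
  resolv a w x =
  expR (a * x) * \int[mu]_(z in `[x, +oo[) (expR (- (a * z)) * w z).
Proof.
move=> a0 mw wK.
have ig : mu.-integrable `[0, +oo[ (EFin \o (fun r : R => K * expR (- (a * r)))).
  by apply: (integrableZl _ _ (integrable_expRN a0)).
have ir : mu.-integrable `[0, +oo[ (EFin \o (fun r => expR (- (a * r)) * w (x + r))).
  apply: integrable_le ig _ => //; first exact: measurable_resolv.
  by move=> r _; rewrite normrM ger0_norm ?expR_ge0// mulrC ler_wpM2r ?expR_ge0.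
rewrite (@Rintegral_affine _ 1 x)//; last first.
  by apply: measurable_funTS; apply: measurable_funM => //; exact: measurable_expRN.
rewrite normr1 mul1r.
have -> : (fun y : R => 1 * y + x) @^-1` `[x, +oo[ = `[0, +oo[.
  by apply/seteqP; split => y /=; rewrite !in_itv/= !andbT mul1r; lra.
transitivity (expR (a * x) * \int[mu]_(r in `[0, +oo[)
    (expR (- (a * x)) * (expR (- (a * r)) * w (x + r)))).
  by rewrite RintegralZl// mulrA -expRD subrr expR0 mul1r.
congr (_ * _); apply: eq_Rintegral => r _.
by rewrite mul1r mulrA -expRD (addrC r); congr (expR _ * _); ring.
Qed.

Lemma resolv_is_derive a w x (K : R) : 0 < a -> continuous_off0 w ->
  (forall y, `|w y| <= K) -> 0 < x ->
  is_derive x 1 (resolv a w) (a * resolv a w x - w x).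
Proof.
move=> a0 cw wK x0; have mw := measurable_off0 cw.
pose k z := expR (- (a * z)) * w z.
have mk : measurable_fun setT k by apply: measurable_funM => //; exact: measurable_expRN.
have ig : mu.-integrable `[0, +oo[ (EFin \o (fun r : R => K * expR (- (a * r)))).
  by apply: (integrableZl _ _ (integrable_expRN a0)).
have ik : mu.-integrable `[0, +oo[ (EFin \o k).
  apply: integrable_le ig _ => //; first exact: measurable_funTS.
  by move=> r _; rewrite normrM ger0_norm ?expR_ge0// mulrC ler_wpM2r ?expR_ge0.
pose I := \int[mu]_(z in `[0, +oo[) k z.
pose U y := \int[mu]_(z in `[0, y]) k z.
have UE y : 0 < y -> resolv a w y = expR (a * y) * (I - U y).
  move=> y0; rewrite (resolv_tailE y a0 mw wK) -/k; congr (_ * _).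
  rewrite /I /U (@Rintegral_itvB _ k (BLeft 0) +oo%O y)// ?bnd_simp ?ltW//.
  rewrite Rintegral_itv_obnd_cbnd//.
  apply: (integrableS _ _ _ ik) => //.
  by apply: subset_itvr; rewrite bnd_simp ltW.
have [dU U'] : derivable U x 1 /\ U^`() x = k x.
  apply: (@continuous_FTC1_closed _ k 0 x (x + 1)) => //.
  - by rewrite ltrDl.
  - apply: (integrableS _ _ _ ik) => //.
    by apply: subset_itvl; rewrite bnd_simp.
  - by apply: cvgM; [exact: continuous_expRN|apply: cw; rewrite gt_eqF].
have {U'} {}dU : is_derive x 1 U (k x) by apply: DeriveDef => //; rewrite -derive1E.
have de : is_derive x 1 (fun y => expR (a * y)) (expR (a * x) * a).
  have da : is_derive x 1 (fun y : R => a * y) a.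
    rewrite (_ : (fun y => _) = a \*: id)//.
    by apply: (is_derive_eq (is_deriveZ _ (is_derive_id _ _))); rewrite [LHS]mulr1.
  exact: (is_derive1_comp _ da).
apply: (near_eq_is_derive (f := (fun y => expR (a * y)) * (cst I - U))).
  near=> y; rewrite UE//; near: y; exact: lt_nbhsr.
apply: (is_derive_eq (is_deriveM de (is_deriveB (is_derive_cst _ _ _) dU))).
rewrite (UE _ x0) /k /GRing.scale/=.
have : expR (a * x) * expR (- (a * x)) = 1 by rewrite -expRD subrr expR0.
move=> h; rewrite -[(cst I - U) x]/(I - U x) -[X in _ = _ - X]mul1r -[X in _ = _ - X * _]h.
ring.
Unshelve. all: by end_near. Qed.

(** The difference of two bounded solutions is a multiple of [expR (a x)], hence
    zero. *)
Lemma resolv_unique a w k (K B : R) x : 0 < a -> continuous_off0 w ->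
  (forall y, `|w y| <= K) -> (forall y, `|k y| <= B) ->
  (forall y, 0 < y -> is_derive y 1 k (a * k y - w y)) ->
  0 < x -> resolv a w x = k x.
Proof.
move=> a0 cw wK kB dk x0; have mw := measurable_off0 cw.
pose d y := expR (- (a * y)) * (resolv a w y - k y).
pose M := K * exp_mass a + B.
have dM y : `|d y| * (1 + a * y) <= M.
  have e0 : 0 < expR (a * y) by exact: expR_gt0.
  have h : `|resolv a w y - k y| <= M.
    apply: (le_trans (ler_normB _ _)); rewrite lerD//.
    exact: resolv_le.
  rewrite /d normrM ger0_norm ?expR_ge0// expRN mulrAC mulrC.
  have M0 : 0 <= M by apply: le_trans h.
  apply: (le_trans (y := M * 1)); last by rewrite mulr1.
  have [y1|y1] := leP 0 (1 + a * y).
    apply: ler_pM => //; first by rewrite mulr_ge0// invr_ge0 ltW.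
    by rewrite mulrC ler_pdivrMr// mul1r expR_ge1Dx.
  apply: (@le_trans _ _ 0); last by rewrite mulr1.
  rewrite mulr_ge0_le0// mulrC; apply: mulr_le0_ge0; rewrite ?invr_ge0; exact: ltW.
have dd y : 0 < y -> is_derive y 1 d 0.
  move=> y0.
  have de : is_derive y 1 (fun y => expR (- (a * y))) (expR (- (a * y)) * - a).
    have da : is_derive y 1 (fun y : R => - (a * y)) (- a).
      rewrite (_ : (fun y => _) = - (a \*: id))//.
      by apply: (is_derive_eq (is_deriveN (is_deriveZ _ (is_derive_id _ _))));
        rewrite [X in - X]mulr1.
    exact: (is_derive1_comp _ da).
  have dr := resolv_is_derive a0 cw wK y0.
  apply: (is_derive_eq (is_deriveM de (is_deriveB dr (dk _ y0)))).
  rewrite /GRing.scale/= -[(resolv a w - k) y]/(resolv a w y - k y); ring.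
have dcst y : x <= y -> d y = d x.
  move=> xy; apply/eqP; rewrite -subr_eq0 -normr_le0.
  rewrite -[leRHS](mul0r (y - x)).
  apply: (@mean_value_le _ d (cst 0) 0 x y xy) => [z /andP[xz _]|z _].
    by apply: dd; exact: lt_le_trans xz.
  by rewrite normr0.
have [d0|d0] := eqVneq (d x) 0.
  move: d0 => /eqP; rewrite /d mulf_eq0 gt_eqF ?expR_gt0//= subr_eq0 => /eqP//.
have nd : 0 < `|d x| by rewrite normr_gt0.
have M0 : 0 <= M.
  apply: le_trans (dM 0); by rewrite mulr_ge0// mulr0 addr0.
(* Far enough for the exponential decay of [d] to contradict [d x != 0]. *)
pose y := x + M / (a * `|d x|).
have xy : x <= y by rewrite lerDl divr_ge0// mulr_ge0// ltW.
have := dM y; rewrite dcst//.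
have -> : `|d x| * (1 + a * y) = `|d x| * (1 + a * x) + M.
  by rewrite /y; field; rewrite !gt_eqF.
rewrite gerDr leNgt mulr_gt0// addr_gt0// mulr_gt0//.
Qed.

End Resolvent.

(** * Continuity of the energy *)
Section Energy.
Context {R : realType}.
Local Notation mu := (@lebesgue_measure R).
Implicit Types (f g P H dH : R -> R) (s t x y z : R) (alpha : R) (beta : \bar R).

Lemma continuous_off0_eq f g : continuous_off0 f -> (forall y, y != 0 -> f y = g y) ->
  continuous_off0 g.
Proof.
move=> cf fg y y0; rewrite /prop_for /continuous_at -(fg _ y0).
apply: cvg_trans (cf _ y0); apply: near_eq_cvg; near=> x; apply: fg.
by near: x; exact: (@cvgr_neq0 _ _ _ _ _ id y).
Unshelve. all: by end_near. Qed.

Lemma sqint_continuous (G : R -> R -> R) (C : R -> R) :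
  (forall S s : R, `|s| <= S -> decaying (C S) (G s)) ->
  (forall s, continuous_off0 (G s)) ->
  (forall x, x != 0 -> continuous (G ^~ x)) ->
  (forall s, mu.-integrable setT (EFin \o (fun x => G s x ^+ 2))) /\
  continuous (fun s => \int[mu]_x (G s x ^+ 2)).
Proof.
move=> dG cG sG.
have mG s : measurable_fun setT (fun x => G s x ^+ 2).
  by apply: measurable_funX; exact: measurable_off0.
have ig S : mu.-integrable setT (EFin \o (fun x : R => C S ^+ 2 * (1 + x ^+ 2)^-1)).
  by apply: (integrableZl _ _ (integrable_decay)).
have Gle S s x : `|s| <= S -> `|G s x ^+ 2| <= C S ^+ 2 * (1 + x ^+ 2)^-1.
  move=> sS; rewrite normrX.
  have d0 : 0 <= (1 + x ^+ 2)^-1 by rewrite invr_ge0 ltW// one_add_sqr_gt0.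
  apply: (@le_trans _ _ ((C S * (1 + x ^+ 2)^-1) ^+ 2)).
    have h := dG _ _ sS x.
    by rewrite ler_pXn2r ?nnegrE//; exact: le_trans h.
  rewrite exprMn ler_wpM2l ?sqr_ge0// expr2 ler_piMr// invf_le1 ?one_add_sqr_gt0//.
  by rewrite lerDl sqr_ge0.
split=> [s|s].
  apply: integrable_le (ig `|s|) _ => // x _; exact: Gle.
apply/(@cvg_nbhsP _ R^o) => u us.
have [S uS] : exists S, forall n, `|u n| <= S.
  have : bounded_fun u by apply: cvg_seq_bounded; apply/cvg_ex; exists s.
  by case=> M [_ hM]; exists (M + 1) => n; apply: (hM (M + 1)) => //; rewrite ltrDl.
apply: (@Rintegral_cvg_dominated _ _ (fun n x => G (u n) x ^+ 2) _
  (fun x : R => C S ^+ 2 * (1 + x ^+ 2)^-1) 0 (fun=> 0)) => //.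
- move=> x _ x0; have cx : G (u n) x @[n --> \oo] --> G s x.
    exact: (cvg_comp _ _ us (sG x x0 s)).
  exact: (cvgM cx cx).
- by move=> n x _ _ _; exact: Gle.
Qed.

(** As a function of [s = sqrt t] the energy extends continuously to the whole
    line. *)
Lemma energy_continuous alpha beta (N G : R -> R -> R) (C b : R -> R) :
  (forall t x, 0 <= t -> x != 0 -> N t x = G (Num.sqrt t) x) ->
  (beta = 1%E -> forall t, 0 <= t -> N t 0 = b (Num.sqrt t)) ->
  continuous b ->
  (forall S s : R, `|s| <= S -> decaying (C S) (G s)) ->
  (forall s, continuous_off0 (G s)) ->
  (forall x, x != 0 -> continuous (G ^~ x)) ->
  (forall t, 0 <= t -> sqnorm alpha beta (N t) \is a fin_num) /\
  {within `[0, +oo[, continuous (fun t => fine (sqnorm alpha beta (N t)))}.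
Proof.
move=> NG Nb cb dG cG sG; have [iG cI] := sqint_continuous dG cG sG.
pose f s := \int[mu]_x (G s x ^+ 2) +
  (alpha ^+ 2)^-1 * (beta == 1%E)%:R * b s ^+ 2.
have Nf t : 0 <= t -> sqnorm alpha beta (N t) = (f (Num.sqrt t))%:E.
  move=> t0; rewrite /sqnorm /f EFinD; congr (_ + _)%E; last first.
    by have [b1|_] := eqVneq beta 1%E; [rewrite Nb|rewrite !mulr0 !mul0r].
  rewrite /Rintegral fineK; last exact: (integrable_fin_num measurableT (iG _)).
  apply: ae_eq_integral => //.
  - apply/measurable_EFinP; apply: measurable_funX; apply: measurable_off0.
    by apply: (continuous_off0_eq (cG (Num.sqrt t))) => y y0; rewrite NG.
  - by apply/measurable_EFinP; apply: measurable_funX; exact: measurable_off0.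
  - by apply: (@negligible_points _ 0 0) => x x0 _ _; rewrite NG.
split=> [t t0|]; first by rewrite Nf.
have cf : continuous f.
  move=> s; apply: cvgD; first exact: cI.
  by apply: cvgM; [exact: cvg_cst|exact: (cvgM (cb s) (cb s))].
have cfs : continuous (fun t => f (Num.sqrt t)).
  by move=> t; apply: (continuous_comp (@sqrt_continuous R t)); exact: cf.
apply: (subspace_eq_continuous (f := fun t => f (Num.sqrt t))); last first.
  exact: continuous_subspaceT.
move=> t; rewrite inE/= in_itv/= andbT => t0.
by rewrite -[RHS]/(fine (sqnorm alpha beta (N t))) Nf.
Qed.

Lemma seminorm_lt_pinfty_bound (D : set R) k H : (seminorm D k 2 H < +oo)%E ->
  exists C, forall y, D y -> `|derive1n k H y| <= C * (1 + y ^+ 2)^-1.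
Proof.
move=> hD; exists (fine (maxe 0 (seminorm D k 2 H))%E) => y Dy.
have : ((`|(1 + `|y| ^+ 2) * derive1n k H y|)%:E <= maxe 0 (seminorm D k 2 H))%E.
  rewrite le_max; apply/orP; right; apply: ereal_sup_ubound.
  by exists y.
rewrite -[X in (_ <= X)%E]fineK; last first.
  rewrite ge0_fin_numE; first by rewrite gt_max ltry.
  by rewrite le_max lexx.
rewrite lee_fin real_normK ?num_real// normrM gtr0_norm ?one_add_sqr_gt0// mulrC.
by rewrite ler_pdivlMr// one_add_sqr_gt0.
Qed.

(** The value of [dH] at the origin is only asked to obey the bound, so that
    [derive1 H] can be taken for [dH] even when [H] jumps there. *)
Definition C1_decaying (C : R) H dH :=
  [/\ forall y, y != 0 -> is_derive y 1 H (dH y), continuous_off0 dH,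
      decaying C H & decaying C dH].

Lemma C1_decaying_schwartz H : smooth_on punctured H ->
  (forall k l, seminorm punctured k l H < +oo)%E ->
  exists C, C1_decaying C H H^`().
Proof.
move=> smH snH.
have [C0 h0] := seminorm_lt_pinfty_bound (snH 0 2)%N.
have [C1 h1] := seminorm_lt_pinfty_bound (snH 1 2)%N.
pose C := Num.max (Num.max `|H 0| `|H^`() 0|) (Num.max C0 C1).
have dge0 y : 0 <= (1 + y ^+ 2)^-1 :> R by rewrite invr_ge0 ltW// one_add_sqr_gt0.
exists C; split.
- move=> y y0; rewrite derive1E; apply: DeriveDef => //.
  exact: (smH 0%N).
- move=> y y0; have d1 : derivable (derive1n 1 H) y 1 by exact: smH.
  exact/differentiable_continuous/derivable1_diffP.
- move=> y; have [->|y0] := eqVneq y 0.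
    by rewrite expr0n/= addr0 invr1 mulr1 !le_max lexx.
  by apply: (le_trans (h0 _ y0)); rewrite ler_wpM2r// !le_max lexx !orbT.
- move=> y; have [->|y0] := eqVneq y 0.
    by rewrite expr0n/= addr0 invr1 mulr1 !le_max lexx !orbT.
  by apply: (le_trans (h1 _ y0)); rewrite ler_wpM2r// !le_max lexx !orbT.
Qed.

End Energy.

(** * The heat flow on the line *)
Section LineEnergy.
Context {R : realType}.
Local Notation mu := (@lebesgue_measure R).
Implicit Types (f g P H dH : R -> R) (s t x y z : R) (alpha : R) (beta : \bar R).

Lemma gavg_continuous_x s P (K : R) x : continuous_off0 P -> (forall y, `|P y| <= K) ->
  (s != 0) || (x != 0) -> {for x, continuous (gavg s P)}.
Proof.
move=> cP PK sx; apply/(@cvg_nbhsP _ R^o) => u ux.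
by apply: (gavg_cvg cP PK _ ux) => //; exact: cvg_cst.
Qed.

Lemma gavg_continuous_s P (K : R) x : continuous_off0 P -> (forall y, `|P y| <= K) ->
  x != 0 -> continuous (gavg ^~ P ^~ x).
Proof.
move=> cP PK x0 s; apply/(@cvg_nbhsP _ R^o) => u us.
by apply: (gavg_cvg cP PK us) => //; [exact: cvg_cst|rewrite x0 orbT].
Qed.

Lemma gavg_continuous_off0 s P (K : R) : continuous_off0 P -> (forall y, `|P y| <= K) ->
  continuous_off0 (gavg s P).
Proof. by move=> cP PK x x0; apply: (gavg_continuous_x cP PK); rewrite x0 orbT. Qed.

(** The constant of [gavg_decaying] at [s = S], which serves all [|s| <= S]. *)
Definition gavg_cst (C S : R) : R := C * (2 * (1 + S ^+ 2) * @gauss_moment R).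

Lemma gavg_decaying_le (C S s : R) P : continuous_off0 P -> decaying C P -> `|s| <= S ->
  decaying (gavg_cst C S) (gavg s P).
Proof.
move=> cP dP sS x; apply: (le_trans (gavg_decaying s (measurable_off0 cP) dP x)).
rewrite ler_wpM2r ?invr_ge0 ?(ltW (one_add_sqr_gt0 x))// ler_wpM2l ?(decaying_ge0 dP)//.
have M0 : 0 <= @gauss_moment R.
  apply: Rintegral_ge0 => y _; rewrite mulr_ge0 ?gauss_ge0//.
  by rewrite (ltW (one_add_sqr_gt0 y)).
rewrite ler_wpM2r// ler_wpM2l// lerD2l -(real_normK (num_real s)).
by rewrite ler_pXn2r// ?nnegrE//; exact: le_trans sS.
Qed.

Lemma gavg_bounded (K : R) s P y : measurable_fun setT P -> (forall y, `|P y| <= K) ->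
  `|gavg s P y| <= K.
Proof.
move=> mP PK; rewrite -[leRHS]mulr1 -(@Rintegral_gauss R) -RintegralZl//;
  last exact: integrable_gauss.
apply: normr_Rintegral_le => //; first exact: measurable_gauss_comp.
  by apply: (integrableZl _ _ integrable_gauss).
by move=> xi _; rewrite normrM ger0_norm ?gauss_ge0// mulrC ler_wpM2r ?gauss_ge0.
Qed.

Lemma gavg_odd0 s P (K : R) : measurable_fun setT P -> (forall y, `|P y| <= K) ->
  (forall y, P (- y) = - P y) -> gavg s P 0 = 0.
Proof.
move=> mP PK oP; suff : gavg s P 0 = - gavg s P 0 by move=> h; lra.
rewrite {1}/gavg (@Rintegral_affine _ (-1) 0)//; last exact: measurable_gauss_comp.
rewrite normrN normr1 mul1r preimage_setT -[RHS]mulN1r /gavg.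
rewrite -RintegralZl//; last exact: (integrable_gauss_comp s 0 mP PK).
apply: eq_Rintegral => xi _.
rewrite mulN1r addr0 gaussN mulN1r -mulrN -oP; congr (_ * P _); ring.
Qed.

Lemma eq_sqrt_sqr t : 0 <= t -> t = Num.sqrt t ^+ 2.
Proof. by move=> t0; rewrite sqr_sqrtr. Qed.

Lemma nabla_off0 f x l : x != 0 -> is_derive x 1 f l -> nabla f x = l.
Proof.
move=> x0 df; rewrite /nabla (negbTE x0) derive1E.
exact: (derive_val (is_derive := df)).
Qed.

Lemma nabla_semigroup0 alpha beta C H dH x : C1_decaying C H dH -> x != 0 ->
  nabla (semigroup alpha beta 0 H) x = dH x.
Proof.
by move=> [dh _ _ _] x0; rewrite /semigroup eqxx; apply: nabla_off0 => //; exact: dh.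
Qed.

Lemma energy_line alpha beta H : (beta < 1)%E -> schwartz H ->
  (forall t, 0 <= t -> sqnorm alpha beta (nabla (semigroup alpha beta t H)) \is a fin_num) /\
  {within `[0, +oo[, continuous
    (fun t => fine (sqnorm alpha beta (nabla (semigroup alpha beta t H))))}.
Proof.
move=> b1 [smH snH].
have le_semi k l : (seminorm punctured k l H < +oo)%E.
  apply: le_lt_trans (snH k l); apply: le_ereal_sup => _ [u _ <-].
  by exists u.
have [//|C tH] := C1_decaying_schwartz _ le_semi; first by move=> k u _; exact: smH.
have [dh cdH dCH dCdH] := tH.
set dH := H^`() in tH dh cdH dCdH *.
have [K dK] := seminorm_lt_pinfty_bound (snH 1 2)%N.
have dHe y : is_derive y 1 H (H^`() y).
  by rewrite derive1E; apply: DeriveDef => //; exact: (smH 0%N).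
have mH : measurable_fun setT H.
  by apply: measurable_off0 => y _; exact: (is_derive_continuous (dHe y)).
have lipH : lipschitz_off0 K H.
  apply: (lipschitz_smooth dHe) => y; apply: (@decaying_bounded _ _ H^`()) => z.
  exact: (dK z).
apply: (@energy_continuous _ alpha beta _ (fun s => gavg s dH) (gavg_cst C) (cst 0)).
- move=> t x; rewrite le_eqVlt => /predU1P[<-|t0] x0.
    by rewrite sqrtr0 gavg0; exact: (nabla_semigroup0 _ _ tH).
  rewrite /semigroup gt_eqF// b1; apply: nabla_off0 => //.
  have s0 : 0 < Num.sqrt t by rewrite sqrtr_gt0.
  rewrite (_ : heat_line t H = gavg (Num.sqrt t) H); last first.
    apply/funext => z; rewrite {1}(eq_sqrt_sqr (ltW t0)).
    exact: (heat_lineE z s0 mH (decaying_bounded dCH)).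
  apply: (gavg_is_derive x _ mH (decaying_bounded dCH) lipH _ dh).
    by rewrite gt_eqF.
  exact: measurable_off0.
- by move=> b; rewrite b ltxx in b1.
- exact: cst_continuous.
- by move=> S s sS; exact: gavg_decaying_le.
- by move=> s; exact: (gavg_continuous_off0 cdH (decaying_bounded dCdH)).
- by move=> x x0; exact: (gavg_continuous_s cdH (decaying_bounded dCdH)).
Qed.

End LineEnergy.

(** * The Neumann flow *)
Section Neumann.
Context {R : realType}.
Local Notation mu := (@lebesgue_measure R).
Implicit Types (f g P H dH : R -> R) (s t x y z : R) (alpha : R) (beta : \bar R).

Lemma near_sign x : x != 0 -> \forall y \near x, sign y = sign x.
Proof.
move=> x0; have [xneg|xpos|/eqP] := ltgtP x 0; last by rewrite (negbTE x0).
- near=> y; have y0 : y < 0 by near: y; exact: lt_nbhsl.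
  by rewrite /sign !leNgt xneg y0.
- near=> y; have y0 : 0 < y by near: y; exact: lt_nbhsr.
  by rewrite /sign (ltW xpos) (ltW y0).
Unshelve. all: by end_near. Qed.

Lemma sgr_sign x : x != 0 -> Num.sg x = sign x.
Proof.
move=> x0; rewrite /sign; case: (ltgtP x 0) x0 => // x1 _.
  by rewrite ltr0_sg.
by rewrite gtr0_sg.
Qed.

Lemma norm_mul_sign x : `|x| * sign x = x.
Proof.
rewrite /sign; case: (leP 0 x) => x0; first by rewrite ger0_norm// mulr1.
by rewrite ltr0_norm// mulrNN mulr1.
Qed.

Lemma sign_sqr x : sign x * sign x = 1.
Proof. by rewrite /sign; case: ifP; rewrite ?mulr1// mulrNN mulr1. Qed.

Lemma signE x : sign x = 1 \/ sign x = -1.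
Proof. by rewrite /sign; case: ifP; [left|right]. Qed.

Lemma normr_sign x : `|sign x| = 1.
Proof. by case: (signE x) => ->; rewrite ?normrN normr1. Qed.

Lemma continuous_off0_sg f : continuous_off0 f ->
  continuous_off0 (fun y => Num.sg y * f y).
Proof.
move=> cf y y0.
have : {for y, continuous (fun z => sign y * f z)}.
  by apply: cvgM; [exact: cvg_cst|exact: cf].
rewrite /prop_for /continuous_at (sgr_sign y0) => h.
apply: cvg_trans h; apply: near_eq_cvg; near=> z.
rewrite sgr_sign; last by near: z; exact: (@cvgr_neq0 _ _ _ _ _ id y).
by congr (_ * _); apply/esym; near: z; exact: near_sign.
Unshelve. all: by end_near. Qed.

Lemma continuous_off0_comp f g : continuous_off0 f -> continuous g ->
  (forall y, y != 0 -> g y != 0) -> continuous_off0 (f \o g).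
Proof. by move=> cf cg g0 y y0; apply: continuous_comp; [exact: cg|exact/cf/g0]. Qed.

Lemma continuous_off0_opp f : continuous_off0 f -> continuous_off0 (fun y => f (- y)).
Proof.
move=> cf; apply: (continuous_off0_comp cf); first exact: opp_continuous.
by move=> y; rewrite oppr_eq0.
Qed.

Lemma is_derive_scale f y l (c : R) : is_derive (c * y) 1 f l ->
  is_derive y 1 (fun x => f (c * x)) (c * l).
Proof.
move=> df; have da : is_derive y 1 (fun y : R => c * y) c.
  rewrite (_ : (fun y => _) = c \*: id)//.
  by apply: (is_derive_eq (is_deriveZ _ (is_derive_id _ _))); rewrite [LHS]mulr1.
by rewrite mulrC; exact: (is_derive1_comp df da).
Qed.

(** For [e = 1] or [e = -1], the even extension of the data carried by the
    half-line of sign [e]; [dmirror] is its derivative off the origin. *)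
Definition mirror (e : R) H : R -> R := fun y => H (`|y| * e).
Definition dmirror (e : R) dH : R -> R := fun y => Num.sg y * (e * dH (`|y| * e)).

Lemma mirror_even e H y : mirror e H (- y) = mirror e H y.
Proof. by rewrite /mirror normrN. Qed.

Section Mirror.
Variables (C : R) (H dH : R -> R) (e : R).
Hypothesis e1 : `|e| = 1.
Hypothesis tH : C1_decaying C H dH.

Let ene0 : e != 0.
Proof. by rewrite -normr_gt0 e1. Qed.

Lemma decaying_mirror P : decaying C P -> decaying C (mirror e P).
Proof.
move=> dP y; apply: (le_trans (dP _)).
by rewrite exprMn real_normK ?num_real// -(real_normK (num_real e)) e1 expr1n mulr1.
Qed.

Lemma decaying_dmirror : decaying C (dmirror e dH).
Proof.
move=> y; case: tH => _ _ _ dd; rewrite /dmirror normrM normrM e1 mul1r.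
apply: le_trans (decaying_mirror dd y); rewrite ler_piMl// normr_sg.
by case: (y != 0).
Qed.

Lemma continuous_off0_dmirror : continuous_off0 (dmirror e dH).
Proof.
case: tH => _ cd _ _; apply: continuous_off0_sg => y y0.
apply: cvgM; first exact: cvg_cst.
apply: (@continuous_off0_comp dH (fun y => `|y| * e)) => //.
  by move=> z; apply: cvgM; [exact: norm_continuous|exact: cvg_cst].
by move=> z z0; rewrite mulf_neq0// normr_eq0.
Qed.

Lemma is_derive_mirror y : y != 0 -> is_derive y 1 (mirror e H) (dmirror e dH y).
Proof.
case: tH => dh _ _ _.
apply: (@is_derive_comp_norm _ (fun r => H (r * e)) (fun r => e * dH (r * e))) => x x0.
rewrite mulrC (_ : (fun r => H (r * e)) = (fun r => H (e * r))); last first.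
  by apply/funext => r; rewrite mulrC.
by rewrite mulrC (mulrC x); apply/is_derive_scale/dh; rewrite mulf_neq0// gt_eqF.
Qed.

Lemma lipschitz_mirror : lipschitz_off0 C (mirror e H).
Proof.
apply: (@lipschitz_even _ _ (dmirror e dH)).
- exact: mirror_even.
- by move=> y y0; apply: is_derive_mirror; rewrite gt_eqF.
- exact: (decaying_bounded decaying_dmirror).
Qed.

Lemma measurable_mirror : measurable_fun setT (mirror e H).
Proof.
apply: measurable_off0 => y y0; exact: (is_derive_continuous (is_derive_mirror y0)).
Qed.

End Mirror.

Lemma C1_decaying_measurable C H dH : C1_decaying C H dH -> measurable_fun setT H.
Proof.
case=> dh _ _ _; apply: measurable_off0 => y y0.
exact: (is_derive_continuous (dh _ y0)).
Qed.

Lemma energy_neumann alpha beta H dH C : (1 < beta)%E -> C1_decaying C H dH ->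
  (forall t, 0 <= t -> sqnorm alpha beta (nabla (semigroup alpha beta t H)) \is a fin_num) /\
  {within `[0, +oo[, continuous
    (fun t => fine (sqnorm alpha beta (nabla (semigroup alpha beta t H))))}.
Proof.
move=> b1 tH; have nb : (beta == 1%E) = false by rewrite gt_eqF.
have [dh cdH dCH dCdH] := tH.
have cm x : continuous_off0 (dmirror (sign x) dH).
  exact: (continuous_off0_dmirror (normr_sign x) tH).
have dm x : decaying C (dmirror (sign x) dH).
  exact: (decaying_dmirror (normr_sign x) tH).
apply: (@energy_continuous _ alpha beta _
  (fun s x => gavg s (dmirror (sign x) dH) x) (gavg_cst C) (cst 0)).
- move=> t x; rewrite le_eqVlt => /predU1P[<-|t0] x0.
    rewrite sqrtr0 gavg0 (nabla_semigroup0 _ _ tH)// /dmirror norm_mul_sign.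
    by rewrite sgr_sign// mulrA sign_sqr mul1r.
  rewrite /semigroup gt_eqF// ltNge (ltW b1)/= nb; apply: nabla_off0 => //.
  have s0 : 0 < Num.sqrt t by rewrite sqrtr_gt0.
  have hE z : heat_neumann t H z = gavg (Num.sqrt t) (mirror (sign z) H) z.
    rewrite {1}(eq_sqrt_sqr (ltW t0)).
    exact: (heat_neumannE z s0 (C1_decaying_measurable tH) (decaying_bounded dCH)).
  apply: (near_eq_is_derive (f := gavg (Num.sqrt t) (mirror (sign x) H))).
    near=> z; rewrite hE; congr (gavg _ (mirror _ H) _); apply/esym; near: z.
    exact: near_sign.
  have e1 := normr_sign x.
  apply: (gavg_is_derive x _ (measurable_mirror e1 tH) _ (lipschitz_mirror e1 tH)
     _ (is_derive_mirror e1 tH)).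
  - by rewrite gt_eqF.
  - exact: (decaying_bounded (decaying_mirror e1 dCH)).
  - exact: measurable_off0.
- by move=> b; rewrite b eqxx in nb.
- exact: cst_continuous.
- move=> S s sS x; exact: (gavg_decaying_le (cm x) (dm x) sS).
- move=> s x x0.
  have h : {for x, continuous (gavg s (dmirror (sign x) dH))}.
    exact: (gavg_continuous_off0 (cm x) (decaying_bounded (dm x))).
  apply: cvg_trans h; apply: near_eq_cvg; near=> z.
  by congr (gavg _ (dmirror _ dH) _); apply/esym; near: z; exact: near_sign.
- by move=> x x0; exact: (gavg_continuous_s (cm x) (decaying_bounded (dm x))).
Unshelve. all: by end_near. Qed.

End Neumann.

(** * The Robin flow *)
Section Robin.
Context {R : realType}.
Local Notation mu := (@lebesgue_measure R).
Implicit Types (f g P : R -> R) (s t x y z : R).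

Lemma decaying_even_part (C : R) f : decaying C f -> decaying C (even_part f).
Proof.
move=> df y; have := df y; have := df (- y); rewrite sqrrN /even_part !ler_norml.
by move=> /andP[? ?] /andP[? ?]; apply/andP; split; lra.
Qed.

Lemma decaying_odd_part (C : R) f : decaying C f -> decaying C (odd_part f).
Proof.
move=> df y; have := df y; have := df (- y); rewrite sqrrN /odd_part !ler_norml.
by move=> /andP[? ?] /andP[? ?]; apply/andP; split; lra.
Qed.

Lemma continuous_off0_even_part f : continuous_off0 f -> continuous_off0 (even_part f).
Proof.
move=> cf y y0; apply: cvgM; last exact: cvg_cst.
by apply: cvgD; [exact: cf|exact: continuous_off0_opp].
Qed.

Lemma continuous_off0_odd_part f : continuous_off0 f -> continuous_off0 (odd_part f).
Proof.
move=> cf y y0; apply: cvgM; last exact: cvg_cst.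
by apply: cvgB; [exact: cf|exact: continuous_off0_opp].
Qed.

Lemma even_partN f y : even_part f (- y) = even_part f y.
Proof. by rewrite /even_part opprK addrC. Qed.

Lemma odd_partN f y : odd_part f (- y) = - odd_part f y.
Proof. by rewrite /odd_part opprK -mulNr opprB. Qed.

Variables (alpha C : R) (H dH : R -> R).
Hypothesis alpha_gt0 : 0 < alpha.
Hypothesis tH : C1_decaying C H dH.

Let dh : forall y, y != 0 -> is_derive y 1 H (dH y). Proof. by case: tH. Qed.
Let cdH : continuous_off0 dH. Proof. by case: tH. Qed.
Let dCH : decaying C H. Proof. by case: tH. Qed.
Let dCdH : decaying C dH. Proof. by case: tH. Qed.
Let a2 : 0 < 2 * alpha. Proof. by rewrite mulr_gt0. Qed.

Lemma is_derive_even_part y : y != 0 -> is_derive y 1 (even_part H) (odd_part dH y).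
Proof.
move=> y0; have dN : is_derive y 1 (fun x => H (- x)) (- dH (- y)).
  by apply/is_derive_comp_opp/dh; rewrite oppr_eq0.
rewrite (_ : even_part H = 2^-1 \*: (H + (fun x => H (- x)))); last first.
  by apply/funext => x; rewrite /even_part mulrC.
apply: (is_derive_eq (is_deriveZ _ (is_deriveD (dh y0) dN))).
by rewrite /odd_part mulrC.
Qed.

Lemma is_derive_odd_part y : y != 0 -> is_derive y 1 (odd_part H) (even_part dH y).
Proof.
move=> y0; have dN : is_derive y 1 (fun x => H (- x)) (- dH (- y)).
  by apply/is_derive_comp_opp/dh; rewrite oppr_eq0.
rewrite (_ : odd_part H = 2^-1 \*: (H - (fun x => H (- x)))); last first.
  by apply/funext => x; rewrite /odd_part mulrC.
apply: (is_derive_eq (is_deriveZ _ (is_deriveB (dh y0) dN))).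
by rewrite opprK /even_part mulrC.
Qed.

(** The derivative, off the origin, of the even function
    [fun y => odd_part H `|y|]. *)
Definition fold_slope y := Num.sg y * even_part dH `|y|.

(** The odd extension of [2 alpha o - o'], [o] being the odd part of [H] on the
    positive half-line. *)
Definition robin_defect y := 2 * alpha * odd_part H y - fold_slope y.

Lemma is_derive_fold y : y != 0 ->
  is_derive y 1 (fun y => odd_part H `|y|) (fold_slope y).
Proof.
by apply: is_derive_comp_norm => x x0; apply: is_derive_odd_part; rewrite gt_eqF.
Qed.

Lemma decaying_fold_slope : decaying C fold_slope.
Proof.
move=> y; rewrite /fold_slope normrM.
apply: (@le_trans _ _ `|even_part dH `|y| |).
  by rewrite ler_piMl// normr_sg; case: (y != 0).
by apply: le_trans (decaying_even_part dCdH `|y|) _; rewrite real_normK ?num_real.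
Qed.

Lemma continuous_off0_fold_slope : continuous_off0 fold_slope.
Proof.
apply: continuous_off0_sg.
apply: (continuous_off0_comp (continuous_off0_even_part cdH)).
  exact: norm_continuous.
by move=> y; rewrite normr_eq0.
Qed.

Lemma lipschitz_fold : lipschitz_off0 C (fun y => odd_part H `|y|).
Proof.
apply: (@lipschitz_even _ _ fold_slope).
- by move=> y; rewrite normrN.
- by move=> y y0; apply: is_derive_fold; rewrite gt_eqF.
- exact: (decaying_bounded decaying_fold_slope).
Qed.

Lemma lipschitz_even_part : lipschitz_off0 C (even_part H).
Proof.
apply: (@lipschitz_even _ _ (odd_part dH)).
- exact: even_partN.
- by move=> y y0; apply: is_derive_even_part; rewrite gt_eqF.
- exact: (decaying_bounded (decaying_odd_part dCdH)).
Qed.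

Let cH : continuous_off0 H.
Proof. by move=> y y0; exact: (is_derive_continuous (dh y0)). Qed.

Let CQ := 2 * alpha * C + C.
Local Notation Q := robin_defect.

Lemma decaying_robin_defect : decaying CQ Q.
Proof.
move=> y; have := decaying_odd_part dCH y; have := decaying_fold_slope y.
rewrite /robin_defect => h1 h2; apply: (le_trans (ler_normB _ _)).
rewrite normrM (gtr0_norm a2) /CQ [leRHS]mulrDl; apply: lerD; last exact: h1.
by rewrite -mulrA ler_wpM2l// ltW.
Qed.

Lemma continuous_off0_robin_defect : continuous_off0 Q.
Proof.
move=> y y0; apply: cvgB; last exact: continuous_off0_fold_slope.
by apply: cvgM; [exact: cvg_cst|exact: continuous_off0_odd_part].
Qed.

Lemma robin_defectN y : Q (- y) = - Q y.
Proof. by rewrite /robin_defect /fold_slope odd_partN sgrN normrN; ring. Qed.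

Let QC := decaying_bounded decaying_robin_defect.
Let mQ := measurable_off0 continuous_off0_robin_defect.
Let gavgQ s : continuous_off0 (gavg s Q).
Proof. exact: (gavg_continuous_off0 continuous_off0_robin_defect QC). Qed.
Let gavgQC s y : `|gavg s Q y| <= CQ.
Proof. exact: gavg_bounded. Qed.

(** On [x > 0], the evolution at time [s ^+ 2] of the odd part of [H]. *)
Definition robin_part s x := resolv (2 * alpha) (gavg s Q) x.

Lemma robin_part_cvg (u v : nat -> R) s x : 0 <= x ->
  u n @[n --> \oo] --> s -> v n @[n --> \oo] --> x ->
  robin_part (u n) (v n) @[n --> \oo] --> robin_part s x.
Proof.
move=> x0 us vx; apply: (@resolv_cvg _ _ (fun n => gavg (u n) Q) v _ x CQ 0) => //.
- by move=> n; apply: measurable_off0; exact: gavgQ.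
- by apply: measurable_off0; exact: gavgQ.
move=> r r0 rn0; apply: (gavg_cvg continuous_off0_robin_defect QC us).
  by apply: cvgD => //; exact: cvg_cst.
by rewrite orbC gt_eqF// ltr_wpDl// lt_neqAle eq_sym rn0.
Qed.

(** At time [0] the odd part itself is a bounded solution of the equation that
    defines [robin_part]. *)
Lemma robin_part0E x : 0 < x -> robin_part 0 x = odd_part H x.
Proof.
move=> x0; rewrite /robin_part (_ : gavg 0 Q = Q); last by apply/funext => y; rewrite gavg0.
apply: (resolv_unique a2 continuous_off0_robin_defect QC
  (decaying_bounded (decaying_odd_part dCH)) _ x0).
move=> y y0; apply: (is_derive_eq (is_derive_odd_part _)); first by rewrite gt_eqF.
by rewrite /robin_defect /fold_slope gtr0_sg// gtr0_norm//; ring.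
Qed.

Definition robin_slope s x := 2 * alpha * robin_part s x - gavg s Q x.

Lemma is_derive_robin_part s x : 0 < x ->
  is_derive x 1 (robin_part s) (robin_slope s x).
Proof. by move=> x0; exact: (resolv_is_derive a2 (@gavgQ _) (gavgQC s)). Qed.

Definition robin_gradient s x := gavg s (odd_part dH) x + robin_slope s `|x|.

(** [resolv_tailE] recognises the outer integral and [robin_kernelE] the inner
    one. *)
Lemma heat_robinE s x : 0 < s -> heat_robin alpha (s ^+ 2) H x =
  gavg s (even_part H) x + sign x * robin_part s `|x|.
Proof.
move=> s0; rewrite /heat_robin; congr (_ + _).
  apply: (heat_lineE x s0 _ (decaying_bounded (decaying_even_part dCH))).
  by apply: measurable_off0; exact: continuous_off0_even_part.
rewrite /robin_part (resolv_tailE _ a2 (measurable_off0 (@gavgQ s)) (gavgQC s)).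
rewrite -mulrA; congr (_ * (_ * _)); apply: eq_Rintegral => z _; congr (_ * _).
apply: (robin_kernelE alpha z s0 (odd_partN H)
  (measurable_off0 (continuous_off0_odd_part cH))
  (decaying_bounded (decaying_odd_part dCH)) lipschitz_fold
  (measurable_off0 continuous_off0_fold_slope)
  (decaying_bounded decaying_fold_slope)).
exact: is_derive_fold.
Qed.

Lemma is_derive_heat_robin s x : 0 < s -> x != 0 ->
  is_derive x 1 (heat_robin alpha (s ^+ 2) H) (robin_gradient s x).
Proof.
move=> s0 x0.
have de : is_derive x 1 (gavg s (even_part H)) (gavg s (odd_part dH) x).
  apply: (gavg_is_derive x _ _ (decaying_bounded (decaying_even_part dCH))
    lipschitz_even_part _ is_derive_even_part).
  - by rewrite gt_eqF.
  - by apply: measurable_off0; exact: continuous_off0_even_part.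
  - by apply: measurable_off0; exact: continuous_off0_odd_part.
have dr : is_derive x 1 (fun x => sign x * robin_part s `|x|) (robin_slope s `|x|).
  have dn := is_derive_comp_norm (is_derive_robin_part s) x0.
  apply: (near_eq_is_derive (f := sign x \*: (fun x => robin_part s `|x|))).
    by near=> z; congr (_ * _); apply/esym; near: z; exact: near_sign.
  apply: (is_derive_eq (is_deriveZ _ dn)).
  by rewrite sgr_sign// /GRing.scale/= mulrA sign_sqr mul1r.
rewrite (_ : heat_robin _ _ _ = gavg s (even_part H) + (fun x => sign x * robin_part s `|x|)).
  exact: is_deriveD.
by apply/funext => z; exact: heat_robinE.
Unshelve. all: by end_near. Qed.

Lemma robin_gradient0E x : x != 0 -> robin_gradient 0 x = dH x.
Proof.
move=> x0; have nx : 0 < `|x| by rewrite normr_gt0.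
rewrite /robin_gradient /robin_slope robin_part0E// !gavg0 /robin_defect /fold_slope.
rewrite gtr0_sg// normr_id /odd_part /even_part.
by case: (ger0P x) => _; rewrite ?opprK; field.
Qed.

Lemma robin_gradient_cvg (u v : nat -> R) s x :
  u n @[n --> \oo] --> s -> v n @[n --> \oo] --> x -> (s != 0) || (x != 0) ->
  robin_gradient (u n) (v n) @[n --> \oo] --> robin_gradient s x.
Proof.
move=> us vx sx.
have nvx : `|v n| @[n --> \oo] --> `|x| by exact: cvg_norm.
apply: cvgD.
  exact: (gavg_cvg (continuous_off0_odd_part cdH)
    (decaying_bounded (decaying_odd_part dCdH)) us vx).
apply: cvgB.
  by apply: cvgM; [exact: cvg_cst|exact: robin_part_cvg].
by apply: (gavg_cvg continuous_off0_robin_defect QC us nvx); rewrite normr_eq0.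
Qed.

Lemma robin_gradient_decaying (S s : R) : `|s| <= S ->
  decaying (gavg_cst C S + (2 * alpha * (gavg_cst CQ S * exp_mass (2 * alpha)) + gavg_cst CQ S))
    (robin_gradient s).
Proof.
move=> sS x.
have dQ := gavg_decaying_le continuous_off0_robin_defect decaying_robin_defect sS.
have K0 := decaying_ge0 dQ.
have h1 := gavg_decaying_le (continuous_off0_odd_part cdH) (decaying_odd_part dCdH) sS x.
have h2 := dQ `|x|; rewrite real_normK ?num_real// in h2.
have h3 : `|robin_part s `|x| | <=
    gavg_cst CQ S * (1 + x ^+ 2)^-1 * exp_mass (2 * alpha).
  apply: resolv_le => //; first by apply: measurable_off0; exact: gavgQ.
  move=> r r0; apply: (le_trans (dQ _)); rewrite ler_wpM2l//.
  rewrite lef_pV2 ?posrE ?one_add_sqr_gt0// lerD2l -(real_normK (num_real x)).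
  by rewrite ler_pXn2r// ?nnegrE ?addr_ge0// lerDl.
rewrite /robin_gradient /robin_slope.
apply: (le_trans (ler_normD _ _)); rewrite [leRHS]mulrDl lerD//.
apply: (le_trans (ler_normB _ _)); rewrite [leRHS]mulrDl lerD//.
rewrite normrM (gtr0_norm a2) -[leRHS]mulrA ler_wpM2l ?(ltW a2)//.
by rewrite mulrAC.
Qed.

End Robin.

(** * The Robin energy and the boundary value of the gradient *)
Section RobinEnergy.
Context {R : realType}.
Implicit Types (s t x y z : R).
Variables (alpha C : R) (H dH : R -> R).
Hypothesis alpha_gt0 : 0 < alpha.
Hypothesis tH : C1_decaying C H dH.

Lemma cvg_odd_part_right (u : nat -> R) : (forall n, 0 < u n) -> u n @[n --> \oo] --> 0 ->
  odd_part H (u n) @[n --> \oo] --> robin_part alpha H dH 0 0.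
Proof.
move=> u0 cu.
rewrite (_ : (fun n => odd_part H (u n)) = (fun n => robin_part alpha H dH 0 (u n))).
  by apply: (robin_part_cvg alpha_gt0 tH (u := fun=> 0)) => //; exact: cvg_cst.
by apply/funext => n; rewrite (robin_part0E alpha_gt0 tH).
Qed.

(** Just left of [0], [H] is its value at the mirror point minus twice the odd
    part; both have limits, the second by continuity of [robin_part] up to the
    boundary. *)
Lemma lderiv0_jump : H x @[x --> 0^'+] --> H 0 ->
  rderiv0 0 H - lderiv0 0 H = 2 * robin_part alpha H dH 0 0.
Proof.
move=> rH; rewrite /rderiv0 /lderiv0 /= (cvg_lim _ rH)//.
have lH : H x @[x --> 0^'-] --> H 0 - 2 * robin_part alpha H dH 0 0.
  apply/cvg_at_leftP => u [u0 cu].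
  have nu n : 0 < - u n by rewrite oppr_gt0.
  have cnu : - u n @[n --> \oo] --> 0 by rewrite -[X in _ --> X]oppr0; exact: cvgN.
  rewrite (_ : (fun n => H (u n)) = (fun n => H (- u n) - 2 * odd_part H (- u n))).
    apply: cvgB; first by move/cvg_at_rightP : rH; apply.
    by apply: cvgM; [exact: cvg_cst|exact: cvg_odd_part_right].
  by apply/funext => n; rewrite /odd_part opprK; field.
by rewrite (cvg_lim _ lH)//; ring.
Qed.

(** For [s > 0] the gradient is continuous up to [x = 0], where the two
    averages of odd functions vanish. *)
Lemma rderiv0_heat_robin s : 0 < s ->
  rderiv0 1 (heat_robin alpha (s ^+ 2) H) = 2 * alpha * robin_part alpha H dH s 0.
Proof.
move=> s0; have [_ cdH dCH dCdH] := tH.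
have g0 : robin_gradient alpha H dH s 0 = 2 * alpha * robin_part alpha H dH s 0.
  rewrite /robin_gradient /robin_slope normr0.
  rewrite (gavg_odd0 s _ (decaying_bounded (decaying_odd_part dCdH)) (odd_partN dH));
    last by apply: measurable_off0; exact: continuous_off0_odd_part.
  rewrite (gavg_odd0 s _ (decaying_bounded (decaying_robin_defect alpha_gt0 tH))
    (robin_defectN alpha H dH)) ?add0r ?subr0//.
  by apply: measurable_off0; exact: continuous_off0_robin_defect tH.
apply/cvg_lim => //; rewrite -g0; apply/cvg_at_rightP => u [u0 cu].
rewrite (_ : (fun n => _) = (fun n => robin_gradient alpha H dH s (u n))).
  apply: (robin_gradient_cvg alpha_gt0 tH (u := fun=> s)) => //; first exact: cvg_cst.
  by rewrite gt_eqF.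
apply/funext => n; rewrite /= derive1E.
have un0 : u n != 0 by rewrite gt_eqF.
exact: (derive_val (is_derive := is_derive_heat_robin alpha_gt0 tH s0 un0)).
Qed.

Lemma energy_robin : H x @[x --> 0^'+] --> H 0 ->
  rderiv0 1 H = alpha * (rderiv0 0 H - lderiv0 0 H) ->
  (forall t, 0 <= t -> sqnorm alpha 1%E (nabla (semigroup alpha 1%E t H)) \is a fin_num) /\
  {within `[0, +oo[, continuous
    (fun t => fine (sqnorm alpha 1%E (nabla (semigroup alpha 1%E t H))))}.
Proof.
move=> rH bH.
apply: (@energy_continuous _ alpha 1%E _ (robin_gradient alpha H dH)
  _ (fun s => 2 * alpha * robin_part alpha H dH s 0)).
- move=> t x; rewrite le_eqVlt => /predU1P[<-|t0] x0.
    by rewrite sqrtr0 (robin_gradient0E alpha_gt0 tH)//; exact: (nabla_semigroup0 _ _ tH).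
  rewrite /semigroup gt_eqF// ltxx eqxx; apply: nabla_off0 => //.
  have s0 : 0 < Num.sqrt t by rewrite sqrtr_gt0.
  by rewrite {1}(eq_sqrt_sqr (ltW t0)); exact: (is_derive_heat_robin alpha_gt0 tH s0 x0).
- move=> _ t; rewrite le_eqVlt => /predU1P[<-|t0].
    rewrite /semigroup eqxx /nabla eqxx bH lderiv0_jump// sqrtr0; ring.
  rewrite /semigroup gt_eqF// ltxx eqxx /nabla eqxx.
  rewrite {1}(eq_sqrt_sqr (ltW t0)) rderiv0_heat_robin//.
  by rewrite sqrtr_gt0.
- move=> s; apply: cvgM; first exact: cvg_cst.
  apply/(@cvg_nbhsP _ R^o) => u us.
  by apply: (robin_part_cvg alpha_gt0 tH) => //; exact: cvg_cst.
- by move=> S s sS; exact: (robin_gradient_decaying alpha_gt0 tH sS).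
- move=> s x x0; apply/(@cvg_nbhsP _ R^o) => u ux.
  apply: (robin_gradient_cvg alpha_gt0 tH (u := fun=> s)) => //; first exact: cvg_cst.
  by rewrite x0 orbT.
- move=> x x0 s; apply/(@cvg_nbhsP _ R^o) => u us.
  apply: (robin_gradient_cvg alpha_gt0 tH (v := fun=> x)) => //; first exact: cvg_cst.
  by rewrite x0 orbT.
Qed.

End RobinEnergy.

Unset Implicit Arguments.
Set Strict Implicit.

Theorem proposition4p4 (R : realType) (alpha : R) (beta : \bar R) (H : R -> R)
    (alpha_gt0 : 0 < alpha) (beta_ge0 : (0 <= beta)%E)
    (H_beta : schwartz_beta alpha beta H) :
  let f := fun t : R => sqnorm alpha beta (nabla (semigroup alpha beta t H)) in
  (forall t : R, 0 <= t -> f t \is a fin_num) /\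
  {within `[0, +oo[, continuous (fun t : R => fine (f t))}.
Proof.
move: H_beta; rewrite /schwartz_beta.
case: ifPn => [b1 sH|]; first exact: energy_line.
rewrite -leNgt => b1; case: ifPn => [/eqP -> [[smH rH snH] bH]|bn1 [[smH rH snH] _]].
  have [C tH] := C1_decaying_schwartz smH snH.
  apply: (energy_robin alpha_gt0 tH rH).
  by have [] := bH 0%N; rewrite muln0 => -> ->.
have [C tH] := C1_decaying_schwartz smH snH.
by apply: (energy_neumann alpha _ tH); rewrite lt_neqAle eq_sym bn1.
Qed.
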